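(* For any $\theta\in[0,\pi/2]$ with $L_\Gamma\cap\partial X_\theta\ne\emptyset$ we have $$\dim_{\mathrm{Hd}}(L_\Gamma^{rad}\cap\partial X_\theta)\le\delta_\theta(\Gamma).$$
   Context: Setting. A Hadamard space is a complete geodesic CAT(0) metric space. $(X_1,d_1)$, $(X_2,d_2)$ are locally compact Hadamard spaces, and $X=X_1\times X_2$ carries the metric $d=\sqrt{d_1^2+d_2^2}$. $\mathrm{Is}(X_i)$ is the isometry group of $X_i$. $\partial X$, $\partial X_i$ are the geometric boundaries (classes of asymptotic geodesic rays, cone topology); $\sigma_{x,\tilde\xi}$ is the geodesic ray from $x$ in the class of $\tilde\xi$. A geodesic line $\sigma:\mathbb R\to Y$ in a Hadamard space $Y$ bounds a flat half-plane if there is a closed convex subset of $Y$ isometric to $[0,\infty)\times\mathbb R$ in which $\sigma(t)$ corresponds to $(0,t)$ for all $t$. An isometry $h$ of a Hadamard space is axial if there are $l>0$ and a geodesic line $\sigma$ with $h(\sigma(t))=\sigma(t+l)$ for all $t\in\mathbb R$; such $\sigma$ is an axis. It is rank one if it has an axis which does not bound a flat half-plane. Two rank one isometries are independent if their fixed point sets in the geometric boundary are disjoint. $\Gamma\subset \mathrm{Is}(X_1)\times \mathrm{Is}(X_2)$ is a discrete group containing elements $g=(g_1,g_2)$ and $h=(h_1,h_2)$ such that for $i=1,2$, $g_i$ and $h_i$ are independent rank one isometries of $X_i$. $o=(o_1,o_2)\in X$ is a fixed base point. Limit set and slope. $L_\Gamma=\overline{\Gamma\cdot x}\cap\partial X$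 (independent of $x\in X$). Every geodesic ray in $X$ has the form $\sigma(t)=(\sigma_1(t\cos\theta),\sigma_2(t\sin\theta))$ with geodesic rays $\sigma_i$ in $X_i$ and $\theta\in[0,\pi/2]$ its slope (a factor being constant if its speed is $0$), which depends only on the boundary point. $\partial X_\theta$ is the set of points of $\partial X$ of slope $\theta$; for $\theta\in(0,\pi/2)$ it is identified with $\partial X_1\times\partial X_2$ and its points are written $(\eta_1,\eta_2,\theta)$; $\partial X_0\cong\partial X_1$ and $\partial X_{\pi/2}\cong\partial X_2$. Radial limit set. A point $\tilde\xi\in\partial X$ is a radial limit point if there is a sequence $\gamma_n=(\gamma_{n,1},\gamma_{n,2})\in\Gamma$ such that $\gamma_no\to\tilde\xi$ and: if $\tilde\xi=(\xi_1,\xi_2,\theta)$ with $\theta\in(0,\pi/2)$, then for both $i\in\{1,2\}$ the sequence $\gamma_{n,i}o_i$ stays at bounded distance of one (hence any) geodesic ray in the class of $\xi_i$; if $\tilde\xi=\xi_i\in\partial X_i$ ($i=1$ for slope $0$, $i=2$ for slope $\pi/2$), then $\gamma_{n,i}o_i$ stays at bounded distance of one (hence any) geodesic ray in the class of $\xi_i$. $L_\Gamma^{rad}$ is the set of radial limit points. Exponent of growth. $\delta_\theta(\Gamma)=\liminf_{\varepsilon\to0}\big(\limsup_{n\to\infty}\frac1n\log N_\theta^\varepsilon(n)\big)$, where $N_\theta^\varepsilon(n)=\#\{\gamma=(\gamma_1,\gamma_2)\in\Gamma: n-1<d(o,\gamma o)\le n,\ |\arctan\frac{d_2(o_2,\gamma_2o_2)}{d_1(o_1,\gamma_1o_1)}-\theta|<\varepsilon\}$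 (with $\arctan(a/0)=\pi/2$ for $a>0$). Hausdorff dimension (following Knieper). Let $c>0$. For $\tilde\xi\in\partial X$ and $0<r<e^{-c}$ the $c$-ball of radius $r$ centered at $\tilde\xi$ is $B_r^c(\tilde\xi)=\{\tilde\eta\in\partial X: d(\sigma_{o,\tilde\eta}(-\log r),\sigma_{o,\tilde\xi}(-\log r))<c\}$. For a Borel set $E\subseteq\partial X$ put $\mathrm{Hd}^\alpha_\varepsilon(E)=\inf\{\sum_j r_j^\alpha: E\subseteq\bigcup_jB^c_{r_j}(\tilde\xi_j),\ r_j<\varepsilon\}$ (countable covers, as for metric spaces), $\mathrm{Hd}^\alpha(E)=\lim_{\varepsilon\to0}\mathrm{Hd}^\alpha_\varepsilon(E)$, and $\dim_{\mathrm{Hd}}(E)=\inf\{\alpha\ge0:\mathrm{Hd}^\alpha(E)<\infty\}$. *)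

(* Defs.v *)
From HB Require Import structures.
From mathcomp Require Import all_boot all_order all_algebra.
From mathcomp Require Import all_classical all_reals all_analysis.
From mathcomp Require Import ring lra.

Set Implicit Arguments.
Unset Strict Implicit.
Unset Printing Implicit Defensive.

Import Order.TTheory GRing.Theory Num.Theory.
Import numFieldNormedType.Exports.

Local Open Scope classical_set_scope.
Local Open Scope ring_scope.

(* The library's metric on [X1 * X2] is the sup metric; [l2prod] is an alias
   carrying the metric sqrt (d1 ^ 2 + d2 ^ 2). *)
Definition l2prod (R : realType) (X1 X2 : metricType R) : Type :=
  (X1 * X2)%type.

HB.instance Definition _ (R : realType) (X1 X2 : metricType R) :=
  Choice.copy (l2prod X1 X2) (X1 * X2)%type.

Section l2prod_metric.
Context {R : realType} {X1 X2 : metricType R}.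
Implicit Types x y z : l2prod X1 X2.

Definition l2dist x y : R :=
  Num.sqrt (mdist x.1 y.1 ^+ 2 + mdist x.2 y.2 ^+ 2).

Let l2dist_xx x : l2dist x x = 0.
Proof. by rewrite /l2dist !mdistxx expr0n addr0 sqrtr0. Qed.

Let l2dist_eq0 x y : l2dist x y = 0 -> x = y.
Proof.
move=> /eqP; rewrite sqrtr_eq0 => h.
have h1 := sqr_ge0 (mdist x.1 y.1); have h2 := sqr_ge0 (mdist x.2 y.2).
have /eqP : mdist x.1 y.1 ^+ 2 = 0 by lra.
have /eqP : mdist x.2 y.2 ^+ 2 = 0 by lra.
rewrite !sqrf_eq0 => /eqP/mdist_positivity e2 /eqP/mdist_positivity e1.
by rewrite (surjective_pairing x) (surjective_pairing y) e1 e2.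
Qed.

Let l2dist_sym x y : l2dist x y = l2dist y x.
Proof. by rewrite /l2dist metric_sym (metric_sym x.2). Qed.

Let minkowski2 (a1 a2 b1 b2 : R) :
  Num.sqrt ((a1 + b1) ^+ 2 + (a2 + b2) ^+ 2) <=
  Num.sqrt (a1 ^+ 2 + a2 ^+ 2) + Num.sqrt (b1 ^+ 2 + b2 ^+ 2).
Proof.
set A := a1 ^+ 2 + a2 ^+ 2; set B := b1 ^+ 2 + b2 ^+ 2.
have A0 : 0 <= A by rewrite addr_ge0 // sqr_ge0.
have B0 : 0 <= B by rewrite addr_ge0 // sqr_ge0.
have cs : a1 * b1 + a2 * b2 <= Num.sqrt A * Num.sqrt B.
  rewrite -sqrtrM//; apply: (le_trans (ler_norm _)).
  rewrite -sqrtr_sqr ler_sqrt ?mulr_ge0//.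
  rewrite -subr_ge0.
  have -> : A * B - (a1 * b1 + a2 * b2) ^+ 2 = (a1 * b2 - a2 * b1) ^+ 2.
    by rewrite /A /B; ring.
  exact: sqr_ge0.
rewrite -[leRHS]ger0_norm ?addr_ge0 ?sqrtr_ge0// -sqrtr_sqr ler_sqrt ?sqr_ge0//.
rewrite [leRHS]sqrrD !sqr_sqrtr// /A /B; nra.
Qed.

Let l2dist_triangle y x z : l2dist x z <= l2dist x y + l2dist y z.
Proof.
apply: le_trans (minkowski2 _ _ _ _).
rewrite ler_sqrt ?addr_ge0 ?sqr_ge0//.
by apply: lerD; rewrite lerXn2r ?nnegrE ?addr_ge0 ?mdist_ge0//;
  exact: metric_triangle.
Qed.

HB.instance Definition _ := isMetric.Build R (l2prod X1 X2)
  l2dist_xx l2dist_eq0 l2dist_sym l2dist_triangle.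

End l2prod_metric.

Definition plane (R : realType) : Type := l2prod R^o R^o.
HB.instance Definition _ (R : realType) := Metric.on (plane R).

Section hadamard.
Context {R : realType} (Y : metricType R).
Implicit Types (p q r x y : Y) (c : R -> Y).

(* Geodesics defined on an interval [I] are represented by functions on the
   whole of [R]; their values outside [I] are irrelevant. *)
Definition geodesic_on (I : set R) c :=
  forall s t, I s -> I t -> mdist (c s) (c t) = `|s - t|.

Definition is_segment p q c :=
  [/\ c 0 = p, c (mdist p q) = q & geodesic_on `[0, mdist p q] c].

Definition is_ray c := geodesic_on `[0, +oo[ c.

Definition is_line c := geodesic_on setT c.

Definition complete_space :=
  forall F : set_system Y, ProperFilter F -> cauchy F -> exists y, F --> y.

Definition geodesic_space := forall p q, exists c, is_segment p q c.

(* Distances between points of a geodesic triangle are at most the distances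
   between their comparison points in a Euclidean comparison triangle
   (p', q', r'). Two points of a triangle lie on two sides with a common vertex,
   here called p; the comparison point of c s is the point x' at distance s
   from p' on the segment [p', q']. *)
Definition CAT0 :=
  forall p q r c1 c2, is_segment p q c1 -> is_segment p r c2 ->
  forall p' q' r' : plane R,
    mdist p' q' = mdist p q -> mdist p' r' = mdist p r ->
    mdist q' r' = mdist q r ->
  forall (s t : R) (x' y' : plane R),
    0 <= s <= mdist p q -> 0 <= t <= mdist p r ->
    mdist p' x' = s -> mdist x' q' = mdist p q - s ->
    mdist p' y' = t -> mdist y' r' = mdist p r - t ->
  mdist (c1 s) (c2 t) <= mdist x' y'.

Definition hadamard := [/\ complete_space, geodesic_space & CAT0].

Definition asymptotic c1 c2 :=
  exists M : R, forall t, 0 <= t -> mdist (c1 t) (c2 t) <= M.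

Record boundary : Type := Boundary {
  rays_of :> (R -> Y) -> Prop ;
  rays_ofP : exists2 c, is_ray c &
    rays_of = [set c' | is_ray c' /\ asymptotic c c'] }.

HB.instance Definition _ := gen_eqMixin boundary.
HB.instance Definition _ := gen_choiceMixin boundary.

(* In a Hadamard space the segment and the ray below exist and are unique on
   [0, mdist x y] and [0, +oo[ respectively. *)
Definition segment x y : R -> Y := xget (fun=> x) [set c | is_segment x y c].

Definition ray_from x (xi : boundary) : R -> Y :=
  xget (fun=> x) [set c | xi c /\ c 0 = x].

Definition geodesically_convex (C : set Y) :=
  forall p q c, C p -> C q -> is_segment p q c ->
  forall t, 0 <= t <= mdist p q -> C (c t).

Definition half_plane : set (plane R) := [set u | 0 <= u.1].

Definition bounds_flat_half_plane c :=
  exists f : plane R -> Y,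
    [/\ {in half_plane &, forall u v, mdist (f u) (f v) = mdist u v},
        forall t : R, f (0, t) = c t,
        closed (f @` half_plane) & geodesically_convex (f @` half_plane)].

Definition isom (h : Y -> Y) :=
  (forall x y, mdist (h x) (h y) = mdist x y) /\ (forall y, exists x, h x = y).

Definition axis (h : Y -> Y) c :=
  is_line c /\ exists2 l : R, 0 < l & forall t, h (c t) = c (t + l).

Definition rank_one (h : Y -> Y) :=
  isom h /\ exists2 c, axis h c & ~ bounds_flat_half_plane c.

(* h xi = xi, where h xi is the class of h \o c for any ray c in xi *)
Definition boundary_fixed (h : Y -> Y) : set boundary :=
  [set xi | forall c, xi c -> xi (h \o c)].

Definition independent_rank_one (g h : Y -> Y) :=
  [/\ rank_one g, rank_one h & boundary_fixed g `&` boundary_fixed h = set0].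

Definition bordification : Type := (Y + boundary)%type.
HB.instance Definition _ := gen_eqMixin bordification.
HB.instance Definition _ := gen_choiceMixin bordification.

Definition cone_nbhd x (xi : boundary) (rho eps : R) : set bordification :=
  [set z | match z with
           | inl y => rho < mdist x y /\
                      mdist (segment x y rho) (ray_from x xi rho) < eps
           | inr eta => mdist (ray_from x eta rho) (ray_from x xi rho) < eps
           end].

Definition cone_subbase : set (set bordification) :=
  [set A | (exists y (e : R), A = inl @` ball y e) \/
           exists x xi (rho eps : R),
             [/\ 0 < rho, 0 < eps & A = cone_nbhd x xi rho eps]].

(* the cone topology on the union of Y and its geometric boundary *)
HB.instance Definition _ :=
  isSubBaseTopological.Build bordification cone_subbase id.

Definition stays_near_class (u : nat -> Y) (xi : boundary) :=
  exists2 c, xi c &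
    exists M : R, forall n, exists2 t : R, 0 <= t & mdist (u n) (c t) <= M.

Local Open Scope ereal_scope.

Definition cball (o : Y) (c : R) (xi : boundary) (r : R) : set boundary :=
  [set eta | (mdist (ray_from o eta (- ln r)) (ray_from o xi (- ln r)) < c)%R].

(* The covers are indexed by a set J of natural numbers, so that finite and
   empty covers are allowed. *)
Definition Hd_pre (o : Y) (c a eps : R) (E : set boundary) : \bar R :=
  ereal_inf [set s | exists (J : set nat) (xi : nat -> boundary) (r : nat -> R),
    [/\ forall j, J j -> (0 < r j < expR (- c))%R /\ (r j < eps)%R,
        E `<=` \bigcup_(j in J) cball o c (xi j) (r j) &
        s = \esum_(j in J) (r j `^ a)%:E]].

Definition Hd (o : Y) (c a : R) (E : set boundary) : \bar R :=
  lim (Hd_pre o c a eps E @[eps --> 0^'+]).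

Definition dim_Hd (o : Y) (c : R) (E : set boundary) : \bar R :=
  ereal_inf [set a%:E | a in [set a : R | (0 <= a)%R /\ Hd o c a E < +oo]].

End hadamard.

Arguments bordification {R} Y.

Section product.
Context {R : realType} (X1 X2 : metricType R).

Notation X := (l2prod X1 X2).
Notation maps := ((X1 -> X1) * (X2 -> X2))%type.
Implicit Types (G : set maps) (g : maps) (o : X) (xi : boundary X).

Definition act g (x : X) : X := (g.1 x.1, g.2 x.2).

Definition isom_group G :=
  [/\ forall g, G g -> isom g.1 /\ isom g.2,
      G (id, id),
      forall g h, G g -> G h -> G (g.1 \o h.1, g.2 \o h.2) &
      forall g, G g -> exists2 h, G h & cancel g.1 h.1 /\ cancel g.2 h.2].

Definition discrete_in_isom G :=
  forall g, G g -> isolated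
    (G : set ({compact-open, X1 -> X1} * {compact-open, X2 -> X2})%type) g.

Definition limit_set G (x : X) : set (boundary X) :=
  [set xi | closure [set (inl (act g x) : bordification X) | g in G]
              (inr xi)].

Definition prod_ray (theta : R) (s1 : R -> X1) (s2 : R -> X2) : R -> X :=
  fun t => (s1 (t * cos theta), s2 (t * sin theta)).

(* A factor of speed 0 need not come from a geodesic ray. *)
Definition boundary_slope (theta : R) : set (boundary X) :=
  [set xi | 0 <= theta <= pi / 2 /\
    exists s1 s2, [/\ cos theta != 0 -> is_ray s1, sin theta != 0 -> is_ray s2 &
                      xi (prod_ray theta s1 s2)]].

(* xi = (eta1, eta2, theta) *)
Definition regular_point xi (eta1 : boundary X1) (eta2 : boundary X2)
    (theta : R) :=
  0 < theta < pi / 2 /\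
  exists s1 s2, [/\ eta1 s1, eta2 s2 & xi (prod_ray theta s1 s2)].

(* xi of slope 0, identified with eta *)
Definition singular_point1 xi (eta : boundary X1) :=
  exists s x2, eta s /\ xi (fun t => (s t, x2)).

(* xi of slope pi / 2, identified with eta *)
Definition singular_point2 xi (eta : boundary X2) :=
  exists s x1, eta s /\ xi (fun t => (x1, s t)).

Definition radial_limit_set G o : set (boundary X) :=
  [set xi | exists g : nat -> maps,
    [/\ forall n, G (g n),
        (inl (act (g n) o) : bordification X) @[n --> \oo]
          --> (inr xi : bordification X) &
        [\/ exists eta1 eta2 theta,
              [/\ regular_point xi eta1 eta2 theta,
                  stays_near_class (fun n => (g n).1 o.1) eta1 &
                  stays_near_class (fun n => (g n).2 o.2) eta2],
            exists2 eta, singular_point1 xi eta &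
              stays_near_class (fun n => (g n).1 o.1) eta |
            exists2 eta, singular_point2 xi eta &
              stays_near_class (fun n => (g n).2 o.2) eta]]].

(* arctan (d2 / d1) with value pi / 2 at d1 = 0 (division by 0 gives 0 in R) *)
Definition orbit_slope o g : R :=
  if mdist o.1 (g.1 o.1) == 0 then pi / 2
  else atan (mdist o.2 (g.2 o.2) / mdist o.1 (g.1 o.1)).

Local Open Scope ereal_scope.

Definition orbit_count G o (theta eps : R) (n : nat) : \bar R :=
  counting [set g | [/\ G g, (n%:R - 1 < mdist o (act g o) <= n%:R)%R &
                        (`|orbit_slope o g - theta| < eps)%R]].

Definition growth_exponent G o (theta : R) : \bar R :=
  limf_einf (fun eps : R =>
    limn_esup (fun n => (n%:R^-1)%:E * lne (orbit_count G o theta eps n))) 0^'+.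

End product.

(* Main.v *)
(* Let a exceed delta_theta. For a radial limit point of slope theta there are
   orbit points g o, with slope as close to theta as we like, such that in each
   factor the ray from o_i passes at bounded distance of g_i o_i. At level
   n - 1 < d(o, g o) <= n there are at most exp(s n) such g, for some s < a, and
   by Hopf-Rinow the boundary points seen by one g are covered by a bounded number
   of balls of radius exp(- l (n - 1)), with l < 1 as close to 1 as we like. The
   sums of the exp(s n) exp(- l a (n - 1)) are bounded, so the a-dimensional
   measure is finite. Points of the limit set provide infinitely many orbit points
   with slope close to theta, hence delta_theta >= 0, which handles the junk value
   ln 0 = -oo in the exponent of growth. *)

Require Import Defs.
From mathcomp Require Import finmap.
From mathcomp Require Import all_boot all_order all_algebra.
From mathcomp Require Import all_classical all_reals all_analysis.
From mathcomp Require Import ring lra.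

Import Order.TTheory GRing.Theory Num.Theory.
Import numFieldNormedType.Exports.

Local Open Scope classical_set_scope.
Local Open Scope ring_scope.

(** * Rays in CAT(0) spaces *)

(** The distance within which an orbit follows its ray is bounded for each radial limit point, but
    not uniformly. Fixing the bound would write the limit set as a countable union of sets of finite
    measure, and finiteness does not pass to such unions. The width of the shadows is therefore
    allowed to grow with the level, slowly enough for the number of balls per shadow to stay at most
    linear. The loss [l < 1] comes from the slopes: an orbit point at distance d whose slope is
    merely close to theta may lie closer to [o_i] in a factor than a ray of slope theta travels in
    time d. Up to time l d this cannot happen, and the gap between s and a pays for the difference.
    The CAT(0) inequality is used in the factors only. The product enters through the fact that the
    components of its geodesics have constant speed, possibly 0; at slope 0 or pi / 2 the idle
    component is the same for all rays from [o], so no control on it is required. *)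

Section cat0.
Context {R : realType} {Y : metricType R}.
Implicit Types (p q r x y : Y) (c : R -> Y).

Lemma sqrt_eq (u k : R) : 0 <= k -> u = k ^+ 2 -> Num.sqrt u = k.
Proof. by move=> k0 ->; rewrite sqrtr_sqr ger0_norm. Qed.

Lemma plane_mdistE (x1 x2 y1 y2 : R) :
  mdist ((x1, x2) : plane R) (y1, y2) =
  Num.sqrt ((x1 - y1) ^+ 2 + (x2 - y2) ^+ 2).
Proof.
rewrite /mdist /= /l2dist /mdist /=; congr Num.sqrt.
by rewrite !real_normK ?num_real //; ring.
Qed.

Lemma mdist_triangle_lower p q r : mdist p q - mdist p r <= mdist q r.
Proof.
by rewrite lerBlDr addrC (metric_sym q); apply: metric_triangle.
Qed.

(** The last fraction is twice the cosine of the comparison angle at [p]: the bound is the law of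
    cosines for the comparison points. All later uses of [CAT0] pass through this inequality. *)
Lemma cat0_cosine p q r c1 c2 (s t : R) : CAT0 Y ->
  is_segment p q c1 -> is_segment p r c2 ->
  0 < mdist p q -> 0 < mdist p r ->
  0 <= s <= mdist p q -> 0 <= t <= mdist p r ->
  mdist (c1 s) (c2 t) ^+ 2 <= s ^+ 2 + t ^+ 2 -
    s * t * ((mdist p q ^+ 2 + mdist p r ^+ 2 - mdist q r ^+ 2)
             / (mdist p q * mdist p r)).
Proof.
move=> cat sg1 sg2 a0 b0 sa tb.
have := cat _ _ _ _ _ sg1 sg2.
have e0 := mdist_ge0 q r.
have eab : mdist q r <= mdist p q + mdist p r.
  by rewrite (metric_sym p q); apply: metric_triangle.
have h1 := mdist_triangle_lower p q r.
have h2 := mdist_triangle_lower p r q.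
rewrite (metric_sym r q) in h2.
move: (mdist p q) (mdist p r) (mdist q r) a0 b0 sa tb e0 eab h1 h2.
move=> a b e a0 b0 /andP[s0 sa] /andP[t0 tb] e0 eab h1 h2.
(* the comparison triangle is (0, 0), (a, 0), (x, y) *)
set x := (a ^+ 2 + b ^+ 2 - e ^+ 2) / (2 * a).
have xa : x * (2 * a) = a ^+ 2 + b ^+ 2 - e ^+ 2.
  by rewrite /x divfK//; lra.
have x_b : x ^+ 2 <= b ^+ 2.
  have h : `|x| <= b.
    rewrite ler_norml -(ler_pM2r (_ : 0 < 2 * a)) ?mulr_gt0//.
    rewrite -(ler_pM2r (_ : 0 < 2 * a) x) ?mulr_gt0// xa.
    by apply/andP; split; nra.
  by rewrite -(real_normK (num_real x)) lerXn2r ?nnegrE ?(ltW b0).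
set y := Num.sqrt (b ^+ 2 - x ^+ 2).
have y2 : y ^+ 2 = b ^+ 2 - x ^+ 2 by rewrite sqr_sqrtr ?subr_ge0.
move=> /(_ (0, 0) (a, 0) (x, y)).
have an0 : a != 0 by lra.
have bn0 : b != 0 by lra.
have s0a : (s / a) * a = s by rewrite divfK.
have t0b : (t / b) * b = t by rewrite divfK.
have t_b0 : 0 <= t / b by rewrite divr_ge0// ltW.
have t_b1 : t / b <= 1 by rewrite ler_pdivrMr// mul1r.
rewrite !plane_mdistE.
have E1 : Num.sqrt ((0 - a) ^+ 2 + (0 - 0) ^+ 2) = a.
  by apply: sqrt_eq; [exact: ltW|ring].
have E2 : Num.sqrt ((0 - x) ^+ 2 + (0 - y) ^+ 2) = b.
  by apply: sqrt_eq; [exact: ltW|rewrite !sub0r !sqrrN y2; ring].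
have E3 : Num.sqrt ((a - x) ^+ 2 + (0 - y) ^+ 2) = e.
  apply: sqrt_eq => //; rewrite sub0r sqrrN y2.
  have -> : (a - x) ^+ 2 + (b ^+ 2 - x ^+ 2) = a ^+ 2 + b ^+ 2 - x * (2 * a).
    by ring.
  by rewrite xa; ring.
move=> /(_ E1 E2 E3 s t (s, 0) (t / b * x, t / b * y)).
rewrite s0 sa t0 tb => /(_ erefl erefl).
rewrite !plane_mdistE.
have F1 : Num.sqrt ((0 - s) ^+ 2 + (0 - 0) ^+ 2) = s.
  by apply: sqrt_eq => //; ring.
have F2 : Num.sqrt ((s - a) ^+ 2 + (0 - 0) ^+ 2) = a - s.
  by apply: sqrt_eq; [lra|ring].
have F3 : Num.sqrt ((0 - t / b * x) ^+ 2 + (0 - t / b * y) ^+ 2) = t.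
  apply: sqrt_eq => //; transitivity ((t / b) ^+ 2 * (x ^+ 2 + y ^+ 2)); first by ring.
  transitivity ((t / b * b) ^+ 2); last by rewrite t0b.
  by rewrite y2; ring.
have F4 : Num.sqrt ((t / b * x - x) ^+ 2 + (t / b * y - y) ^+ 2) = b - t.
  apply: sqrt_eq; first lra.
  transitivity ((t / b - 1) ^+ 2 * (x ^+ 2 + y ^+ 2)); first by ring.
  transitivity ((b - t / b * b) ^+ 2); last by rewrite t0b.
  by rewrite y2; ring.
move=> /(_ F1 F2 F3 F4).
rewrite -(ler_pXn2r (_ : 0 < 2)%N) ?nnegrE ?sqrtr_ge0 ?mdist_ge0//.
rewrite sqr_sqrtr ?addr_ge0 ?sqr_ge0//.
move/le_trans; apply.
rewrite sub0r sqrrN exprMn y2.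
have -> : (s - t / b * x) ^+ 2 + (t / b) ^+ 2 * (b ^+ 2 - x ^+ 2) =
          s ^+ 2 + (t / b * b) ^+ 2 - s * (t / b) * (2 * x) by ring.
rewrite t0b -xa le_eqVlt; apply/orP; left; apply/eqP; field.
by rewrite an0 bn0.
Qed.

(** At the same fraction [l] of both sides the bound of [cat0_cosine] is exactly the square of
    [l * mdist q r]. Sides of length 0, which have no angle, are treated apart. *)
Lemma cat0_convex p q r c1 c2 (l : R) : CAT0 Y ->
  is_segment p q c1 -> is_segment p r c2 -> 0 <= l <= 1 ->
  mdist (c1 (l * mdist p q)) (c2 (l * mdist p r)) <= l * mdist q r.
Proof.
move=> cat sg1 sg2 /andP[l0 l1].
have [c10 _ g1] := sg1; have [c20 _ g2] := sg2.
have itv (a : R) : 0 <= a -> 0 <= l * a <= a.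
  by move=> a0; rewrite mulr_ge0//= ler_piMl.
have [a0|a0] := eqVneq (mdist p q) 0.
  have pq := mdist_positivity _ _ a0.
  rewrite a0 mulr0 c10 -[X in mdist X (c2 _)]c20 g2 /= ?in_itv/= ?itv ?lexx ?mdist_ge0//.
  by rewrite sub0r normrN ger0_norm ?mulr_ge0 ?mdist_ge0// pq.
have [b0|b0] := eqVneq (mdist p r) 0.
  have pr := mdist_positivity _ _ b0.
  rewrite b0 mulr0 c20 -[X in mdist _ X]c10 g1 /= ?in_itv/= ?itv ?lexx ?mdist_ge0//.
  by rewrite subr0 ger0_norm ?mulr_ge0 ?mdist_ge0// pr metric_sym.
have a_gt0 : 0 < mdist p q by rewrite lt_neqAle eq_sym a0 mdist_ge0.
have b_gt0 : 0 < mdist p r by rewrite lt_neqAle eq_sym b0 mdist_ge0.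
rewrite -(ler_pXn2r (_ : 0 < 2)%N) ?nnegrE ?mulr_ge0 ?mdist_ge0//.
apply: le_trans (cat0_cosine _ _ _ _ _ _ _ cat sg1 sg2 a_gt0 b_gt0 _ _) _;
  rewrite ?itv ?mdist_ge0//.
rewrite le_eqVlt; apply/orP; left; apply/eqP; field.
by rewrite a0 b0.
Qed.

Lemma is_segment_rev p q c : is_segment p q c ->
  is_segment q p (fun t => c (mdist p q - t)).
Proof.
move=> [c0 c1 g]; split; rewrite ?subr0//= (metric_sym q) ?subrr//.
move=> s t /=; rewrite !in_itv/= => /andP[s0 s1] /andP[t0 t1].
rewrite g /= ?in_itv/=; first by rewrite distrC; congr `|_|; ring.
  by apply/andP; split; lra.
by apply/andP; split; lra.
Qed.

Lemma is_segment_ray c (n : R) : is_ray c -> 0 <= n ->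
  is_segment (c 0) (c n) c.
Proof.
move=> rc n0; have dn : mdist (c 0) (c n) = n.
  by rewrite rc /= ?in_itv/= ?lexx ?n0// sub0r normrN ger0_norm.
split=> //; first by rewrite dn.
by move=> s t /=; rewrite !in_itv/= => /andP[s0 _] /andP[t0 _];
  apply: rc; rewrite /= in_itv/= ?s0 ?t0.
Qed.

End cat0.

Section rays.
Context {R : realType} {Y : metricType R}.
Implicit Types (p q r x y : Y) (c : R -> Y).

Lemma complete_seq (u : nat -> Y) : complete_space Y ->
  (forall e : R, 0 < e ->
     exists N, forall n, (N <= n)%N -> mdist (u N) (u n) < e) ->
  exists y, forall e : R, 0 < e ->
     exists N, forall n, (N <= n)%N -> mdist y (u n) < e.
Proof.
move=> cY cu.
have [|y uy] := cY (u @ \oo).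
  apply: cauchy_exP => e e0; have [N uN] := cu _ e0.
  exists (u N); exists N => // n /= Nn.
  by rewrite ballEmdist /=; apply: uN.
exists y => e e0; have [|N _ uN] := uy (ball y e).
  exact: nbhsx_ballx.
by exists N => n Nn; have := uN n Nn; rewrite /= ballEmdist.
Qed.

(** Seen from [x], two far points of the ray subtend a small comparison angle, so the segments
    towards them agree up to [e] at the fixed time [s]. *)
Lemma segments_cauchy x c (sg : nat -> R -> Y) (s : R) : hadamard Y ->
  is_ray c -> (forall n : nat, is_segment x (c n%:R) (sg n)) -> 0 <= s ->
  forall e : R, 0 < e ->
    exists N, forall n, (N <= n)%N -> mdist (sg N s) (sg n s) < e.
Proof.
move=> [_ _ cat] rc sgP s0 e e0.
set D := mdist x (c 0).
have D0 : 0 <= D by exact: mdist_ge0.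
have cn (m n : nat) : (m <= n)%N -> mdist (c m%:R) (c n%:R) = n%:R - m%:R.
  move=> mn; rewrite rc /= ?in_itv/= ?ler0n// distrC ger0_norm//.
  by rewrite subr_ge0 ler_nat.
have dn (n : nat) : n%:R - D <= mdist x (c n%:R) <= n%:R + D.
  have := cn _ _ (leq0n n); rewrite subr0.
  have := metric_triangle x (c 0) (c n%:R).
  have := metric_triangle (c 0) x (c n%:R).
  rewrite (metric_sym _ x) -/D => h1 h2 h3; apply/andP; split; lra.
(* The quotient is the length beyond which the final estimate [4 * D * s ^+ 2 / a] drops below
   [e ^+ 2]; the other terms make both segments longer than [s]. *)
set B := D + s + 4 * D * s ^+ 2 / e ^+ 2 + 1.
have B0 : 0 <= 4 * D * s ^+ 2 / e ^+ 2.
  by rewrite divr_ge0 ?mulr_ge0 ?sqr_ge0// ltW.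
have [N BN] : exists N : nat, B < N%:R.
  exists (Num.bound `|B|); apply: le_lt_trans (ler_norm _) _.
  exact: archi_boundP.
exists N => n Nn.
rewrite -(ltr_pXn2r (_ : 0 < 2)%N) ?nnegrE ?mdist_ge0 ?(ltW e0)//.
have /andP[aN1 aN2] := dn N; have /andP[an1 an2] := dn n.
have NnR : (N%:R <= n%:R :> R) by rewrite ler_nat.
have a_s : s + 4 * D * s ^+ 2 / e ^+ 2 + 1 <= mdist x (c N%:R).
  by rewrite /B in BN; lra.
have a0 : 0 < mdist x (c N%:R) by lra.
have b0 : 0 < mdist x (c n%:R) by rewrite /B in BN; lra.
apply: le_lt_trans (cat0_cosine _ _ _ _ _ s s cat (sgP N) (sgP n) _ _ _ _) _ => //.
- by apply/andP; split => //; lra.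
- by apply/andP; split => //; rewrite /B in BN; lra.
rewrite (cn _ _ Nn).
have eb : n%:R - N%:R <= mdist x (c n%:R) by rewrite /B in BN; lra.
have fin : 4 * D * s ^+ 2 < e ^+ 2 * mdist x (c N%:R).
  by rewrite [ltRHS]mulrC -ltr_pdivrMr ?exprn_gt0//; lra.
have ab := mdist_triangle_lower x (c N%:R) (c n%:R).
have ba := mdist_triangle_lower x (c n%:R) (c N%:R).
rewrite (metric_sym (c n%:R)) in ba; rewrite (cn _ _ Nn) in ab ba.
move: (mdist x (c N%:R)) (mdist x (c n%:R)) aN1 aN2 an1 an2 a_s a0 b0 eb fin ab ba.
move=> a b aN1 aN2 an1 an2 a_s a0 b0 eb fin ab ba.
set m := n%:R - N%:R in eb *.
have m0 : 0 <= m by rewrite subr_ge0.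
(* d(sg N s, sg n s)^2 <= s^2 (m^2 - (a - b)^2) / (a b), where b - a is within
   2 D of m, so that the numerator is only linear in m *)
have abm : m ^+ 2 - (a - b) ^+ 2 <= 4 * D * m.
  have -> : m ^+ 2 - (a - b) ^+ 2 = (m - (b - a)) * (m + (b - a)) by ring.
  have -> : 4 * D * m = (2 * D) * (2 * m) by ring.
  by rewrite ler_pM//; rewrite /m in ab ba *; lra.
have -> : s ^+ 2 + s ^+ 2 - s * s * ((a ^+ 2 + b ^+ 2 - m ^+ 2) / (a * b)) =
          s ^+ 2 * (m ^+ 2 - (a - b) ^+ 2) / (a * b).
  by field; rewrite !gt_eqF.
rewrite ltr_pdivrMr ?mulr_gt0// mulrA.
apply: (@le_lt_trans _ _ (4 * D * s ^+ 2 * b)).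
  apply: (@le_trans _ _ (s ^+ 2 * (4 * D * m))).
    by rewrite ler_wpM2l ?sqr_ge0.
  have : 0 <= 4 * D * s ^+ 2 * (b - m).
    by rewrite !mulr_ge0 ?sqr_ge0 ?subr_ge0.
  nra.
by rewrite ltr_pM2r.
Qed.

Lemma mdist_lt_eq0 x y : (forall e : R, 0 < e -> mdist x y < e) -> x = y.
Proof.
move=> xy; apply: mdist_positivity; apply/eqP.
rewrite eq_le mdist_ge0 andbT leNgt; apply/negP => d0.
by have := xy _ d0; rewrite ltxx.
Qed.

Lemma asymptotic_sym c1 c2 : asymptotic c1 c2 -> asymptotic c2 c1.
Proof. by move=> [M cM]; exists M => t t0; rewrite metric_sym cM. Qed.

Lemma asymptotic_trans c2 c1 c3 :
  asymptotic c1 c2 -> asymptotic c2 c3 -> asymptotic c1 c3.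
Proof.
move=> [M cM] [M' cM']; exists (M + M') => t t0.
by apply: le_trans (metric_triangle _ (c2 t) _) _; rewrite lerD ?cM ?cM'.
Qed.

(** The ray is the pointwise limit of the segments from [x] to [c n]. *)
Lemma exists_asymptotic_ray x c : hadamard Y -> is_ray c ->
  exists r : R -> Y, [/\ is_ray r, r 0 = x & asymptotic c r].
Proof.
move=> hY rc; have [cY gY cat] := hY.
have [sg sgP] := choice (fun n : nat => gY x (c n%:R)).
have : forall s : R, exists y, 0 <= s -> forall e : R, 0 < e ->
     exists N, forall n, (N <= n)%N -> mdist y (sg n s) < e.
  move=> s; have [s0|s0] := leP 0 s; last by exists x.
  have [|y yP] := complete_seq (sg ^~ s) cY; last by exists y => _.
  exact: (segments_cauchy x c sg s hY rc sgP s0).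
move=> /choice[r rP].
set D := mdist x (c 0).
have dn (n : nat) : n%:R - D <= mdist x (c n%:R) <= n%:R + D.
  have : mdist (c 0) (c n%:R) = n%:R.
    by rewrite rc /= ?in_itv/= ?ler0n ?lexx// sub0r normrN ger0_norm.
  have := metric_triangle x (c 0) (c n%:R).
  have := metric_triangle (c 0) x (c n%:R).
  rewrite (metric_sym _ x) -/D => h1 h2 h3; apply/andP; split; lra.
have big (s : R) : exists N : nat, forall n, (N <= n)%N ->
    s <= mdist x (c n%:R) /\ s < n%:R.
  exists (Num.bound (`|s| + D)) => n Nn; have /andP[h _] := dn n.
  have D0 : 0 <= D by exact: mdist_ge0.
  have := archi_boundP (_ : 0 <= `|s| + D).
  rewrite addr_ge0// => /(_ isT) lt1.
  have : (Num.bound (`|s| + D))%:R <= n%:R :> R by rewrite ler_nat.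
  by have := ler_norm s; lra.
exists r; split.
- move=> s t /=; rewrite !in_itv/= !andbT => s0 t0.
  suff : `|mdist (r s) (r t) - `|s - t| | <= 0.
    by rewrite normr_le0 subr_eq0 => /eqP.
  apply/ler_addgt0Pl => e e0; rewrite addr0.
  have e20 : 0 < e / 2 by rewrite divr_gt0.
  have [N1 hN1] := rP s s0 _ e20; have [N2 hN2] := rP t t0 _ e20.
  have [N3 hN3] := big (Num.max s t).
  set n := maxn N1 (maxn N2 N3).
  have h1 := hN1 n (leq_maxl _ _).
  have h2 := hN2 n (leq_trans (leq_maxl _ _) (leq_maxr _ _)).
  have [] := hN3 n (leq_trans (leq_maxr _ _) (leq_maxr _ _)).
  rewrite ge_max => /andP[sa ta] _.
  have [_ _ g] := sgP n.
  have := g s t; rewrite /= !in_itv/= s0 t0 sa ta => /(_ isT isT) gst.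
  have t1 := metric_triangle (r s) (sg n s) (r t).
  have t2 := metric_triangle (sg n s) (sg n t) (r t).
  have t3 := metric_triangle (sg n s) (r s) (sg n t).
  have t4 := metric_triangle (r s) (r t) (sg n t).
  rewrite (metric_sym (sg n t) (r t)) in t2; rewrite (metric_sym (sg n s) (r s)) in t3.
  by rewrite ler_norml; lra.
- apply: mdist_lt_eq0 => e e0; have [N] := rP 0 (lexx _) _ e0.
  by move=> /(_ N (leqnn _)); have [-> _ _] := sgP N.
(* One [D] is convexity seen from the far end [c n], the other the difference between the lengths of
   the two sides ending there, and 1 the distance to the limit. *)
- exists (2 * D + 1) => s s0.
  have [N1 hN1] := rP s s0 _ ltr01; have [N2 hN2] := big s.
  set n := maxn N1 N2.
  have h1 := hN1 n (leq_maxl _ _); have [sa sn] := hN2 n (leq_maxr _ _).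
  have n0 : 0 < n%:R :> R by lra.
  have /andP[dn1 dn2] := dn n.
  set a := mdist x (c n%:R) in sa dn1 dn2.
  have sn0 : 0 <= s / n%:R by rewrite divr_ge0// ltW.
  have sn1 : s / n%:R <= 1 by rewrite ler_pdivrMr// mul1r ltW.
  have l01 : 0 <= 1 - s / n%:R <= 1 by lra.
  have cvx := cat0_convex _ _ _ _ _ _ cat (is_segment_rev _ _ _ (sgP n))
    (is_segment_rev _ _ _ (is_segment_ray _ _ rc (ltW n0))) l01.
  have dnn : mdist (c 0) (c n%:R) = n%:R.
    by rewrite rc /= ?in_itv/= ?ler0n ?lexx// sub0r normrN ger0_norm.
  rewrite (metric_sym (c n%:R) x) (metric_sym (c n%:R) (c 0)) dnn -/a -/D in cvx.
  have E1 : a - (1 - s / n%:R) * a = s / n%:R * a by ring.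
  have E2 : n%:R - (1 - s / n%:R) * n%:R = s.
    by rewrite mulrBl mul1r divfK ?gt_eqF//; ring.
  rewrite E1 E2 in cvx.
  have D0 : 0 <= D by exact: mdist_ge0.
  have cvx' : mdist (sg n (s / n%:R * a)) (c s) <= D.
    by apply: le_trans cvx _; rewrite ler_piMl//; lra.
  have [_ _ g] := sgP n.
  have a0 : 0 <= a by exact: mdist_ge0.
  have gs : mdist (sg n s) (sg n (s / n%:R * a)) <= D.
    rewrite g /= ?in_itv/= ?s0 -?/a ?sa ?mulr_ge0 ?ler_piMl//.
    have -> : s - s / n%:R * a = s / n%:R * (n%:R - a).
      by rewrite mulrBr divfK ?gt_eqF.
    rewrite normrM (ger0_norm sn0); apply: le_trans (ler_piMl _ sn1) _ => //.
    by rewrite ler_norml; lra.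
  have t1 := metric_triangle (c s) (sg n (s / n%:R * a)) (r s).
  have t2 := metric_triangle (sg n (s / n%:R * a)) (sg n s) (r s).
  rewrite (metric_sym (c s) (sg _ _)) in t1.
  rewrite (metric_sym _ (sg n s)) (metric_sym (sg n s) (r s)) in t2.
  by lra.
Qed.

End rays.

(** * Hopf-Rinow *)

Section hopf_rinow.
Context {R : realType} {Y : metricType R}.
Implicit Types (A B K : set Y) (x y z o : Y) (e r : R) (Z : seq Y).

(** The centres need not lie in [A], so that subsets inherit the net with the same [e]. *)
Definition has_net e A :=
  exists Z, forall y, A y -> exists2 z, z \in Z & mdist z y < e.

Definition tot_bounded A := forall e, 0 < e -> has_net e A.

Lemma has_netU e A B : has_net e A -> has_net e B -> has_net e (A `|` B).
Proof.
move=> [Z1 h1] [Z2 h2]; exists (Z1 ++ Z2) => y [/h1|/h2] [z zZ zy];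
  by exists z; rewrite // mem_cat zZ ?orbT.
Qed.

Lemma has_net_sub e A B : A `<=` B -> has_net e B -> has_net e A.
Proof. by move=> AB [Z h]; exists Z => y /AB /h. Qed.

Lemma tot_boundedU A B : tot_bounded A -> tot_bounded B ->
  tot_bounded (A `|` B).
Proof. by move=> hA hB e e0; apply: has_netU; [exact: hA|exact: hB]. Qed.

Lemma tot_bounded_sub A B : A `<=` B -> tot_bounded B -> tot_bounded A.
Proof. by move=> AB hB e e0; apply: has_net_sub AB _; exact: hB. Qed.

Lemma ultra_has_net (U : set_system Y) e A : UltraFilter U -> U A ->
  has_net e A -> exists z, U (ball z e).
Proof.
move=> uU UA [Z]; elim: Z A UA => [|z Z IH] A UA AZ.
  suff A0 : A = set0 by have := filter_not_empty U; rewrite -A0 => /(_ _ UA).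
  by rewrite -subset0 => y /AZ[].
have [Uz|Uz] := in_ultra_setVsetC (ball z e) uU; first by exists z.
apply: (IH (A `&` ~` ball z e)); first exact: filterI.
move=> y [/AZ[t]]; rewrite inE ballEmdist /= => /orP[/eqP ->|tZ] ty //.
by exists t.
Qed.

(** The complements of a proper ideal form a proper filter. This turns a failure of total
    boundedness into an ultrafilter whose limit can be examined. *)
Lemma ultra_avoiding (I : set_system Y) :
  (forall A B, A `<=` B -> I B -> I A) ->
  (forall A B, I A -> I B -> I (A `|` B)) ->
  I set0 -> ~ I setT ->
  exists2 U, UltraFilter U & forall A, I A -> U (~` A).
Proof.
move=> Isub IU I0 IT; pose F : set_system Y := [set A | I (~` A)].
have FF : ProperFilter F.
  split; first by rewrite /F /= setC0.
  split; rewrite /F /=.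
  - by rewrite setCT.
  - by move=> A B IA IB; apply: Isub (IU _ _ IA IB); rewrite -setCI.
  - by move=> A B AB; apply: Isub; exact: subsetC.
have [U [uU FU]] := ultraFilterLemma FF.
by exists U => // A IA; apply: FU; rewrite /F /= setCK.
Qed.

(** Without a net, some ultrafilter on [K] avoids every set whose trace on [K] has one; yet it
    contains a ball around its limit. *)
Lemma compact_tot_bounded K : compact K -> tot_bounded K.
Proof.
rewrite compact_ultra => cK e e0; apply: contrapT => nK.
have [| | | |U uU UI] := ultra_avoiding [set A | has_net e (K `&` A)].
- by move=> A B AB /=; apply: has_net_sub; exact: setIS.
- by move=> A B /= hA hB; rewrite setIUr; exact: has_netU.
- by exists [::] => y; rewrite setI0.
- by rewrite /= setIT.
have UK : U K.
  by rewrite -[K]setCK; apply: UI; rewrite /= setICr; exists [::].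
have [x [_ Ux]] := cK U uU UK.
have xI : has_net e (K `&` ball x e).
  by exists [:: x] => y [_]; rewrite ballEmdist /=; exists x; rewrite ?inE.
have : U (ball x e `&` ~` ball x e).
  by apply: filterI; [apply: Ux; exact: nbhsx_ballx|exact: UI].
by rewrite setICr; exact: (filter_not_empty U).
Qed.

Lemma hopf_rinow o r : complete_space Y -> geodesic_space Y ->
  locally_compact [set: Y] -> tot_bounded [set y | mdist o y <= r].
Proof.
move=> cY gY lcY; apply: contrapT => nr.
pose C r := [set y | mdist o y <= r].
have Csub s t : s <= t -> C s `<=` C t by move=> st y /le_trans; apply.
pose S : set R := [set s | 0 <= s /\ tot_bounded (C s)].
have S0 : S 0.
  split=> // e e0; exists [:: o] => y /= h; exists o; first by rewrite inE.
  exact: le_lt_trans e0.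
have ubS : has_ubound S.
  exists r => s [_ hs]; rewrite leNgt; apply/negP => rs; apply: nr.
  by apply: tot_bounded_sub hs; apply: Csub; exact: ltW.
(* No neighbourhood of the ball of radius rho is totally bounded, although they
   all have finite nets at each scale larger than their thickness. An
   ultrafilter avoiding totally bounded sets is then Cauchy, and its limit has
   no compact neighbourhood. *)
set rho := sup S.
have rho0 : 0 <= rho by exact: ub_le_sup.
have nC d : 0 < d -> ~ tot_bounded (C (rho + d)).
  move=> d0 hd; have : rho + d <= rho.
    by apply: ub_le_sup => //; split => //; lra.
  lra.
have [| | | |U uU UI] := ultra_avoiding
  [set A | exists2 d, 0 < d & tot_bounded (C (rho + d) `&` A)].
- move=> A B AB /= [d d0 hd]; exists d => //.
  by apply: tot_bounded_sub hd; exact: setIS.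
- move=> A B /= [d d0 hd] [d' d'0 hd']; exists (Num.min d d').
    by rewrite lt_min d0.
  rewrite setIUr; apply: tot_boundedU.
    by apply: tot_bounded_sub hd; apply: setSI; apply: Csub; rewrite lerD2l ge_min lexx.
  by apply: tot_bounded_sub hd'; apply: setSI; apply: Csub;
    rewrite lerD2l ge_min lexx orbT.
- by exists 1 => // e e0; exists [::] => y; rewrite setI0.
- by move=> [d d0]; rewrite setIT; exact: nC.
have UC d : 0 < d -> U (C (rho + d)).
  move=> d0; rewrite -[C _]setCK; apply: UI; exists d => //.
  by rewrite setICr => e e0; exists [::].
have [|y Uy] := cY U.
  (* A point of [C (rho + d)] can be moved back by at most [2 * d] along a geodesic to [o] to reach
     [C s], whose net of mesh [d] then serves with mesh [3 * d < e]. *)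
  apply: cauchy_exP => e e0; pose d := e / 4.
  have d0 : 0 < d by rewrite /d; lra.
  have [|s [s0 hs] rs] := sup_gt (ex_intro _ _ S0) (_ : rho - d < sup S); first by rewrite -/rho; lra.
  apply: (ultra_has_net U e _ uU (UC d d0)).
  have [Z hZ] := hs d d0; exists Z => y /= yC.
  have [y' [y's y'y]] : exists y', C s y' /\ mdist y' y <= 2 * d.
    have [ys|sy] := leP (mdist o y) s.
      by exists y; split => //; rewrite mdistxx; lra.
    have [c [c0 c1 g]] := gY o y.
    have g1 : mdist (c 0) (c s) = `|0 - s|.
      by apply: g; rewrite /= in_itv/= ?lexx ?s0 ?mdist_ge0 ?(ltW sy).
    have g2 : mdist (c s) (c (mdist o y)) = `|s - mdist o y|.
      by apply: g; rewrite /= in_itv/= ?lexx ?s0 ?mdist_ge0 ?(ltW sy).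
    rewrite c0 in g1; rewrite c1 in g2.
    exists (c s); rewrite /C /= g1 g2.
    rewrite sub0r normrN distrC !ger0_norm ?subr_ge0 ?(ltW sy)//; split => //.
    have : mdist o y <= rho + d by [].
    by lra.
  have [z zZ zy'] := hZ _ y's; exists z => //.
  by have := metric_triangle z y' y; rewrite /d in y'y zy'; lra.
have [K Ky [cK _]] := lcY y I.
have NK : nbhs y K by move: Ky; rewrite withinET.
have : U (K `&` ~` K).
  apply: filterI; first exact: Uy.
  apply: UI; exists 1 => //; apply: tot_bounded_sub (compact_tot_bounded _ cK).
  exact: subIsetr.
by rewrite setICr; exact: (filter_not_empty U).
Qed.

End hopf_rinow.

(** * Geodesics and slopes in the product *)

Section constant_speed.
Context {R : realType} {Y : metricType R}.
Implicit Types (c : R -> Y) (a b : R).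

(** Describes the components of a ray of the product, including the constant ones, for which
    [a = 0]. *)
Definition constant_speed a c := forall s t, 0 <= s -> 0 <= t ->
  mdist (c s) (c t) = a * `|s - t|.

Lemma constant_speed_scale b c : 0 <= b -> (b != 0 -> is_ray c) ->
  constant_speed b (fun t => c (t * b)).
Proof.
move=> b0 rc s t s0 t0; have [->|bn0] := eqVneq b 0.
  by rewrite !mulr0 mdistxx mul0r.
rewrite (rc bn0) /= ?in_itv/= ?mulr_ge0// -mulrBl normrM mulrC.
by rewrite (ger0_norm b0).
Qed.

(** [|a - b| * t] stays bounded. Hence the slope can be read off any ray of a class. *)
Lemma asymptotic_speed a b c1 c2 : constant_speed a c1 ->
  constant_speed b c2 -> asymptotic c1 c2 -> a = b.
Proof.
move=> h1 h2 [M cM].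
set B := M + mdist (c1 0) (c2 0).
have bnd t : 0 <= t -> `|a - b| * t <= B.
  move=> t0; have e1 := h1 0 t (lexx _) t0; have e2 := h2 0 t (lexx _) t0.
  rewrite sub0r normrN ger0_norm// in e1 e2.
  have := cM t t0.
  have := metric_triangle (c1 0) (c2 0) (c1 t).
  have := metric_triangle (c2 0) (c2 t) (c1 t).
  have := metric_triangle (c2 0) (c1 0) (c2 t).
  have := metric_triangle (c1 0) (c1 t) (c2 t).
  rewrite (metric_sym (c2 0) (c1 0)) (metric_sym (c2 t)) e1 e2 => ? ? ? ? ?.
  by rewrite -[X in _ * X](ger0_norm t0) -normrM ler_norml mulrBl /B; lra.
have B0 : 0 <= B by have := bnd 0 (lexx _); rewrite mulr0.
apply/eqP; rewrite -subr_eq0 -normr_eq0 eq_le normr_ge0 andbT leNgt.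
apply/negP => ab0; have := bnd ((B + 1) / `|a - b|).
have B10 : 0 <= B + 1 by lra.
rewrite divr_ge0// => /(_ isT).
by rewrite mulrC divfK ?gt_eqF//; lra.
Qed.

Lemma boundary_asymptotic (xi : boundary Y) c1 c2 : xi c1 -> is_ray c2 ->
  asymptotic c1 c2 -> xi c2.
Proof.
have [c rc ->] := rays_ofP xi => /= -[rc1 ac1] rc2 a12; split => //.
exact: asymptotic_trans a12.
Qed.

Lemma boundary_ray (xi : boundary Y) c : xi c -> is_ray c.
Proof. by have [c' _ ->] := rays_ofP xi => -[]. Qed.

Lemma boundary_rays_asymptotic (xi : boundary Y) c1 c2 : xi c1 -> xi c2 ->
  asymptotic c1 c2.
Proof.
have [c _ ->] := rays_ofP xi => -[_ a1] [_ a2].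
exact: asymptotic_trans (asymptotic_sym _ _ a1) a2.
Qed.

Lemma ray_fromP (x : Y) (xi : boundary Y) : (exists2 c, xi c & c 0 = x) ->
  xi (ray_from x xi) /\ ray_from x xi 0 = x.
Proof.
by move=> [c xic c0]; rewrite /ray_from; case: xgetP => [_ -> //|/(_ c)[]].
Qed.

Lemma segmentP (x y : Y) : geodesic_space Y -> is_segment x y (segment x y).
Proof.
move=> gY; rewrite /segment; case: xgetP => [_ -> //|].
by have [c cP] := gY x y => /(_ c).
Qed.

End constant_speed.

Section l2_product.
Context {R : realType} {X1 X2 : metricType R}.
Notation X := (l2prod X1 X2).
Implicit Types (x y : X) (c : R -> X).

Lemma l2_mdistE x y :
  mdist x y = Num.sqrt (mdist x.1 y.1 ^+ 2 + mdist x.2 y.2 ^+ 2).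
Proof. by []. Qed.

Lemma l2_mdist_sqr x y :
  mdist x y ^+ 2 = mdist x.1 y.1 ^+ 2 + mdist x.2 y.2 ^+ 2.
Proof. by rewrite l2_mdistE sqr_sqrtr// addr_ge0 ?sqr_ge0. Qed.

Lemma l2_mdist1 x y : mdist x.1 y.1 <= mdist x y.
Proof.
rewrite -(ler_pXn2r (_ : 0 < 2)%N) ?nnegrE ?mdist_ge0//.
by rewrite l2_mdist_sqr lerDl sqr_ge0.
Qed.

Lemma l2_mdist2 x y : mdist x.2 y.2 <= mdist x y.
Proof.
rewrite -(ler_pXn2r (_ : 0 < 2)%N) ?nnegrE ?mdist_ge0//.
by rewrite l2_mdist_sqr lerDr sqr_ge0.
Qed.

Lemma l2_mdist_le x y : mdist x y <= mdist x.1 y.1 + mdist x.2 y.2.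
Proof.
rewrite -(ler_pXn2r (_ : 0 < 2)%N) ?nnegrE ?addr_ge0 ?mdist_ge0//.
rewrite l2_mdist_sqr sqrrD addrAC lerDl.
by rewrite mulrn_wge0// mulr_ge0 ?mdist_ge0.
Qed.

Lemma asymptotic_l2 c1 c2 : asymptotic c1 c2 <->
  asymptotic (fun t => (c1 t).1) (fun t => (c2 t).1) /\
  asymptotic (fun t => (c1 t).2) (fun t => (c2 t).2).
Proof.
split=> [[M cM]|[[M cM] [M' cM']]].
  by split; exists M => t /cM; apply: le_trans; rewrite (l2_mdist1, l2_mdist2).
exists (M + M') => t t0; apply: le_trans (l2_mdist_le _ _) _.
by rewrite lerD ?cM ?cM'.
Qed.

(** Here [v], [w], [z] stand for the factor distances between the points at times 0 and [s], [s] and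
    [t], 0 and [t] of a geodesic of the product. Minkowski's inequality is an equality there, which
    forces equality in both triangle inequalities and proportional increments. *)
Lemma minkowski_equality (v1 v2 w1 w2 z1 z2 s t : R) : 0 < s -> s <= t ->
  0 <= v1 -> 0 <= v2 -> 0 <= w1 -> 0 <= w2 -> 0 <= z1 -> 0 <= z2 ->
  v1 ^+ 2 + v2 ^+ 2 = s ^+ 2 -> w1 ^+ 2 + w2 ^+ 2 = (t - s) ^+ 2 ->
  z1 ^+ 2 + z2 ^+ 2 = t ^+ 2 -> z1 <= v1 + w1 -> z2 <= v2 + w2 ->
  [/\ s * w1 = (t - s) * v1, s * w2 = (t - s) * v2,
      s * z1 = t * v1 & s * z2 = t * v2].
Proof.
move=> s0 st v10 v20 w10 w20 z10 z20 hv hw hz le1 le2.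
have q1 : z1 ^+ 2 <= (v1 + w1) ^+ 2 by rewrite lerXn2r ?nnegrE ?addr_ge0.
have q2 : z2 ^+ 2 <= (v2 + w2) ^+ 2 by rewrite lerXn2r ?nnegrE ?addr_ge0.
(* The equality case of Cauchy-Schwarz makes v and w parallel. *)
have dot : s * (t - s) <= v1 * w1 + v2 * w2 by nra.
have par : ((t - s) * v1 - s * w1) ^+ 2 + ((t - s) * v2 - s * w2) ^+ 2 <= 0.
  have -> : ((t - s) * v1 - s * w1) ^+ 2 + ((t - s) * v2 - s * w2) ^+ 2 =
    (t - s) ^+ 2 * (v1 ^+ 2 + v2 ^+ 2) + s ^+ 2 * (w1 ^+ 2 + w2 ^+ 2)
    - 2 * (s * (t - s)) * (v1 * w1 + v2 * w2) by ring.
  rewrite hv hw.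
  have : 0 <= (s * (t - s)) * (v1 * w1 + v2 * w2 - s * (t - s)).
    by rewrite mulr_ge0 ?subr_ge0// mulr_ge0 ?subr_ge0// ltW.
  by nra.
have p1 : (t - s) * v1 - s * w1 = 0.
  by apply/eqP; rewrite -sqrf_eq0 eq_le sqr_ge0 andbT;
    have := sqr_ge0 ((t - s) * v2 - s * w2); lra.
have p2 : (t - s) * v2 - s * w2 = 0.
  by apply/eqP; rewrite -sqrf_eq0 eq_le sqr_ge0 andbT;
    have := sqr_ge0 ((t - s) * v1 - s * w1); lra.
have e1 : s * (v1 + w1) = t * v1 by lra.
have e2 : s * (v2 + w2) = t * v2 by lra.
have tot : s ^+ 2 * ((v1 + w1) ^+ 2 + (v2 + w2) ^+ 2) =
           s ^+ 2 * (z1 ^+ 2 + z2 ^+ 2).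
  rewrite hz mulrDr -!exprMn e1 e2 !exprMn -mulrDr hv; ring.
have tot' : (v1 + w1) ^+ 2 + (v2 + w2) ^+ 2 = z1 ^+ 2 + z2 ^+ 2.
  by apply: mulfI tot; rewrite sqrf_eq0 gt_eqF.
have z1E : z1 = v1 + w1.
  apply/eqP; rewrite -(eqrXn2 (_ : 0 < 2)%N) ?addr_ge0//.
  by apply/eqP; lra.
have z2E : z2 = v2 + w2.
  apply/eqP; rewrite -(eqrXn2 (_ : 0 < 2)%N) ?addr_ge0//.
  by apply/eqP; lra.
by rewrite z1E z2E e1 e2; split => //; lra.
Qed.

Lemma l2_geodesic_components c (L s t : R) : geodesic_on `[0, L] c ->
  0 < s -> s <= t -> t <= L ->
  [/\ s * mdist (c s).1 (c t).1 = (t - s) * mdist (c 0).1 (c s).1,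
      s * mdist (c s).2 (c t).2 = (t - s) * mdist (c 0).2 (c s).2,
      s * mdist (c 0).1 (c t).1 = t * mdist (c 0).1 (c s).1 &
      s * mdist (c 0).2 (c t).2 = t * mdist (c 0).2 (c s).2].
Proof.
move=> gc s0 st tL; have t0 := lt_le_trans s0 st.
have d0s : mdist (c 0) (c s) = s.
  rewrite gc /= ?in_itv/= ?lexx ?(ltW s0) ?(ltW t0) ?(le_trans st tL)//.
    by rewrite sub0r normrN ger0_norm// ltW.
  exact: le_trans (ltW t0) tL.
have d0t : mdist (c 0) (c t) = t.
  rewrite gc /= ?in_itv/= ?lexx ?(ltW t0) ?tL//.
    by rewrite sub0r normrN ger0_norm// ltW.
  exact: le_trans (ltW t0) tL.
have dst : mdist (c s) (c t) = t - s.
  rewrite gc /= ?in_itv/= ?(ltW s0) ?(ltW t0) ?tL ?(le_trans st tL)//.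
  by rewrite distrC ger0_norm// subr_ge0.
by apply: minkowski_equality; rewrite ?mdist_ge0 -?l2_mdist_sqr ?d0s ?d0t ?dst//;
  exact: metric_triangle.
Qed.

Lemma l2_ray_components c : is_ray c ->
  exists a1 a2, constant_speed a1 (fun t => (c t).1) /\
                constant_speed a2 (fun t => (c t).2).
Proof.
move=> rc.
have gc L : geodesic_on `[0, L] c.
  by move=> s t /=; rewrite !in_itv/= => /andP[s0 _] /andP[t0 _];
    apply: rc; rewrite /= in_itv/= ?s0 ?t0.
exists (mdist (c 0).1 (c 1).1), (mdist (c 0).2 (c 1).2).
have lin t : 0 < t -> mdist (c 0).1 (c t).1 = t * mdist (c 0).1 (c 1).1 /\
                      mdist (c 0).2 (c t).2 = t * mdist (c 0).2 (c 1).2.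
  move=> t0; have [t1|/ltW t1] := leP 1 t.
    by have [_ _ <- <-] := l2_geodesic_components _ t _ _ (gc t) ltr01 t1 (lexx _);
      rewrite !mul1r.
  have [_ _ e1 e2] := l2_geodesic_components _ 1 _ _ (gc 1) t0 t1 (lexx _).
  by rewrite e1 e2 !mul1r.
have main s t : 0 < s -> s <= t ->
    mdist (c s).1 (c t).1 = mdist (c 0).1 (c 1).1 * (t - s) /\
    mdist (c s).2 (c t).2 = mdist (c 0).2 (c 1).2 * (t - s).
  move=> s0 st; have [l1 l2] := lin s s0.
  have [e1 e2 _ _] := l2_geodesic_components _ t _ _ (gc t) s0 st (lexx _).
  have sn0 : s != 0 by rewrite gt_eqF.
  by split; apply: (mulfI sn0); rewrite ?e1 ?e2 ?l1 ?l2; ring.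
have main0 s t : 0 <= s -> s <= t ->
    mdist (c s).1 (c t).1 = mdist (c 0).1 (c 1).1 * (t - s) /\
    mdist (c s).2 (c t).2 = mdist (c 0).2 (c 1).2 * (t - s).
  rewrite le_eqVlt => /orP[/eqP <-|]; last exact: main.
  rewrite le_eqVlt => /orP[/eqP <-|t0]; first by rewrite !mdistxx subrr !mulr0.
  by rewrite subr0 !(mulrC _ t); exact: lin.
split=> s t s0 t0; (have [st|/ltW ts] := leP s t;
  [have [e1 e2] := main0 s t s0 st|have [e1 e2] := main0 t s t0 ts]).
- by rewrite e1 distrC ger0_norm ?subr_ge0.
- by rewrite metric_sym e1 ger0_norm ?subr_ge0.
- by rewrite e2 distrC ger0_norm ?subr_ge0.
- by rewrite metric_sym e2 ger0_norm ?subr_ge0.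
Qed.

Lemma l2_is_ray c (a1 a2 : R) : a1 ^+ 2 + a2 ^+ 2 = 1 ->
  constant_speed a1 (fun t => (c t).1) ->
  constant_speed a2 (fun t => (c t).2) -> is_ray c.
Proof.
move=> a12 h1 h2 s t; rewrite /= !in_itv/= !andbT => s0 t0.
rewrite l2_mdistE; apply: sqrt_eq => //.
by rewrite h1// h2// !exprMn -mulrDl a12 mul1r.
Qed.

(** Gives meaning to [segment] in the product, on which its cone neighbourhoods rest. *)
Lemma l2_geodesic_space : geodesic_space X1 -> geodesic_space X2 ->
  geodesic_space X.
Proof.
move=> g1 g2 x y; have [c1 [c10 c1y gc1]] := g1 x.1 y.1.
have [c2 [c20 c2y gc2]] := g2 x.2 y.2.
have [L0|Ln0] := eqVneq (mdist x y) 0.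
  exists (fun=> x); split; rewrite ?L0 //; first exact: mdist_positivity.
  move=> s t /=; rewrite !in_itv/= => /andP[s0 s1] /andP[t0 t1].
  have -> : s = 0 by lra.
  have -> : t = 0 by lra.
  by rewrite mdistxx subrr normr0.
have L0 : 0 < mdist x y by rewrite lt_neqAle eq_sym Ln0 mdist_ge0.
have itv (d s : R) : 0 <= d -> 0 <= s <= mdist x y ->
    0 <= s * (d / mdist x y) <= d.
  move=> d0 /andP[s0 s1]; rewrite mulr_ge0 ?divr_ge0 ?mdist_ge0//=.
  by rewrite mulrA ler_pdivrMr// mulrC ler_wpM2l.
exists (fun t => (c1 (t * (mdist x.1 y.1 / mdist x y)),
                  c2 (t * (mdist x.2 y.2 / mdist x y)))); split.
- by rewrite !mul0r c10 c20 -surjective_pairing.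
- by rewrite !(mulrC (mdist x y)) !divfK// c1y c2y -surjective_pairing.
move=> s t /= sI tI; rewrite l2_mdistE /=; apply: sqrt_eq => //.
rewrite !in_itv/= in sI tI.
rewrite gc1 /= ?in_itv/= ?itv ?mdist_ge0//.
rewrite gc2 /= ?in_itv/= ?itv ?mdist_ge0//.
rewrite -!mulrBl !normrM !exprMn -mulrDr.
rewrite !normfV !exprVn -mulrDl !real_normK ?num_real// -l2_mdist_sqr.
by rewrite divff ?mulr1// sqrf_eq0.
Qed.

End l2_product.

(** * Angles in the first quadrant *)

Section angles.
Context {R : realType}.
Implicit Types (a b e t u th : R).

Lemma cos_quadrant_ge0 t : 0 <= t <= pi / 2 -> 0 <= cos t.
Proof.
move=> /andP[t0 t1]; apply: cos_ge0_pihalf; rewrite t1 andbT.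
by apply: le_trans t0; rewrite oppr_le0 divr_ge0 ?pi_ge0.
Qed.

Lemma sin_quadrant_ge0 t : 0 <= t <= pi / 2 -> 0 <= sin t.
Proof.
move=> /andP[t0 t1]; apply: sin_ge0_pi; rewrite t0 /=.
by apply: le_trans t1 _; rewrite ler_pdivrMr// ler_peMr ?pi_ge0// ler1n.
Qed.

Lemma atan_div a b : 0 < a -> 0 <= b ->
  [/\ 0 <= atan (b / a) <= pi / 2,
      Num.sqrt (a ^+ 2 + b ^+ 2) * cos (atan (b / a)) = a &
      Num.sqrt (a ^+ 2 + b ^+ 2) * sin (atan (b / a)) = b].
Proof.
move=> a0 b0; have an0 : a != 0 by rewrite gt_eqF.
have cosE : Num.sqrt (a ^+ 2 + b ^+ 2) * cos (atan (b / a)) = a.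
  rewrite cos_atan.
  have -> : a ^+ 2 + b ^+ 2 = a ^+ 2 * (1 + (b / a) ^+ 2) by field.
  rewrite sqrtrM ?sqr_ge0// sqrtr_sqr ger0_norm ?(ltW a0)// mulfK//.
  by rewrite gt_eqF// sqrtr_gt0 ltr_wpDr ?sqr_ge0.
split=> //.
  rewrite (ltW (atan_ltpi2 _)) andbT -(atan0 R); apply: le_atan.
  by rewrite divr_ge0// ltW.
have c0 : cos (atan (b / a)) != 0.
  by apply/eqP => c0; move: cosE; rewrite c0 mulr0 => /esym/eqP; rewrite gt_eqF.
have := atanK (b / a); rewrite /tan => /(canRL (mulfVK c0)) ->.
by rewrite mulrCA cosE divfK.
Qed.

(** The addition formula bounds sin (t - u) by the sum of the two differences, and sine increases up
    to pi / 2. *)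
Lemma angle_close e : 0 < e -> exists2 eta : R, 0 < eta &
  forall t u, 0 <= t <= pi / 2 -> 0 <= u <= pi / 2 ->
  `|cos t - cos u| < eta -> `|sin t - sin u| < eta -> `|t - u| < e.
Proof.
move=> e0; have pi2 : 0 < pi / 2 :> R by rewrite divr_gt0 ?pi_gt0.
pose e' := Num.min e (pi / 2).
have e'0 : 0 < e' by rewrite lt_min e0.
have e'pi : e' <= pi / 2 by rewrite ge_min lexx orbT.
have sin_e' : 0 < sin e'.
  rewrite -(sin0 R) ltr_sin// in_itv/= ?e'pi ?andbT ?oppr_le0 ?(ltW pi2)//.
  by apply: le_trans (ltW e'0); rewrite oppr_le0 ltW.
exists (sin e' / 2); first by rewrite divr_gt0.
have main t u : 0 <= t <= pi / 2 -> 0 <= u <= pi / 2 ->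
  `|cos t - cos u| < sin e' / 2 -> `|sin t - sin u| < sin e' / 2 ->
  t - u < e.
  move=> tI uI hc hs; rewrite ltNge; apply/negP => etu.
  have : sin e' <= sin (t - u).
    have e'tu : e' <= t - u by apply: le_trans etu; rewrite ge_min lexx.
    have /andP[t0 t1] := tI; have /andP[u0 u1] := uI.
    rewrite le_eqVlt; move: e'tu; rewrite le_eqVlt => /orP[/eqP ->|lt'].
      by rewrite eqxx.
    by apply/orP; right; rewrite ltr_sin// in_itv/=; apply/andP; split; lra.
  rewrite sinB.
  have -> : sin t * cos u - cos t * sin u =
    (sin t - sin u) * cos u - (cos t - cos u) * sin u by ring.
  have b1 : (sin t - sin u) * cos u < sin e' / 2.
    apply: le_lt_trans hs; apply: le_trans (ler_norm _) _; rewrite normrM.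
    by rewrite ler_piMr// cos_max.
  have b2 : - ((cos t - cos u) * sin u) < sin e' / 2.
    apply: le_lt_trans hc; apply: le_trans (ler_norm _) _.
    by rewrite normrN normrM ler_piMr// sin_max.
  lra.
move=> t u tI uI hc hs; rewrite ltr_norml main// andbT ltrNl opprB main//.
  by rewrite distrC.
by rewrite distrC.
Qed.

(** Continuity in multiplicative form: where [cos th] or [sin th] vanishes, nonnegativity suffices,
    so the end points of the quadrant are included. *)
Lemma quadrant_ratio th l : 0 <= th <= pi / 2 -> l < 1 ->
  exists2 e : R, 0 < e & forall t, 0 <= t <= pi / 2 -> `|t - th| < e ->
  l * cos th <= cos t /\ l * sin th <= sin t.
Proof.
move=> thI l1.
have gen (f : R -> R) : {for th, continuous f} ->
    (forall t, 0 <= t <= pi / 2 -> 0 <= f t) ->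
    exists2 e : R, 0 < e & forall t, 0 <= t <= pi / 2 -> `|t - th| < e ->
    l * f th <= f t.
  move=> cf f0; have [fth0|fthn0] := eqVneq (f th) 0.
    by exists 1 => // t tI _; rewrite fth0 mulr0 f0.
  have fth : 0 < f th by rewrite lt_neqAle eq_sym fthn0 f0.
  have eps0 : 0 < (1 - l) * f th by rewrite mulr_gt0 ?subr_gt0.
  have /cvgrPdist_lt/(_ _ eps0)/nbhs_ballP[e /= e0 he] := cf.
  exists e => // t tI te; have := he t; rewrite /ball /= distrC => /(_ te).
  by rewrite ltr_norml => /andP[_]; lra.
have [e1 e10 h1] := gen cos (@continuous_cos R th) cos_quadrant_ge0.
have [e2 e20 h2] := gen sin (@continuous_sin R th) sin_quadrant_ge0.
exists (Num.min e1 e2); first by rewrite lt_min e10.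
by move=> t tI; rewrite lt_min => /andP[te1 te2]; split; [exact: h1|exact: h2].
Qed.

End angles.

(** * Slopes of orbit points and of boundary points *)

Section slope.
Context {R : realType} {X1 X2 : metricType R}.
Notation X := (l2prod X1 X2).
Implicit Types (o x y : X) (g : (X1 -> X1) * (X2 -> X2)) (xi : boundary X).

Lemma orbit_slopeP o g : 0 < mdist o (act g o) ->
  [/\ 0 <= orbit_slope o g <= pi / 2,
      mdist o (act g o) * cos (orbit_slope o g) = mdist o.1 (g.1 o.1) &
      mdist o (act g o) * sin (orbit_slope o g) = mdist o.2 (g.2 o.2)].
Proof.
rewrite /orbit_slope l2_mdistE /=.
have := mdist_ge0 o.1 (g.1 o.1); have := mdist_ge0 o.2 (g.2 o.2).
set a := mdist o.1 _; set b := mdist o.2 _ => b0 a0 L0.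
have [a_eq0|an0] := eqVneq a 0; last first.
  by apply: atan_div => //; rewrite lt_neqAle eq_sym an0.
rewrite a_eq0 cos_pihalf sin_pihalf mulr0 mulr1 expr0n add0r sqrtr_sqr.
by rewrite ger0_norm// lexx divr_ge0 ?pi_ge0.
Qed.

(** A ray from [o] in the class is assembled from asymptotic rays in the factors, a factor of speed
    0 staying at its base point. The ray chosen by [ray_from] may be another one, but asymptotic
    rays have the same speeds. *)
Lemma ray_from_slope o xi th : hadamard X1 -> hadamard X2 ->
  boundary_slope th xi ->
  [/\ xi (ray_from o xi), ray_from o xi 0 = o,
      constant_speed (cos th) (fun t => (ray_from o xi t).1) &
      constant_speed (sin th) (fun t => (ray_from o xi t).2)].
Proof.
move=> hX1 hX2 [thI [s1 [s2 [r1 r2 xis]]]].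
have c0 := cos_quadrant_ge0 _ thI; have s0 := sin_quadrant_ge0 _ thI.
have ex (Y : metricType R) (y : Y) (b : R) (s : R -> Y) : hadamard Y -> 0 <= b ->
    (b != 0 -> is_ray s) -> exists r, [/\ b != 0 -> is_ray r, r 0 = y &
      asymptotic (fun t => s (t * b)) (fun t => r (t * b))].
  move=> hY b0; have [->|bn0] := eqVneq b 0 => [_|/(_ isT) rs].
    exists (fun=> y); split => //; exists (mdist (s 0) y) => t _.
    by rewrite mulr0.
  have [r [rr rx [M sr]]] := exists_asymptotic_ray y s hY rs.
  by exists r; split => //; exists M => t t0; rewrite sr// mulr_ge0.
have [q1 [rq1 q10 a1]] := ex _ o.1 _ _ hX1 c0 r1.
have [q2 [rq2 q20 a2]] := ex _ o.2 _ _ hX2 s0 r2.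
have [|xir ro] := ray_fromP o xi.
  exists (prod_ray th q1 q2).
    apply: boundary_asymptotic xis _ _; last exact/asymptotic_l2.
    apply: (l2_is_ray _ _ _ (cos2Dsin2 th)); exact: constant_speed_scale.
  by rewrite /prod_ray !mul0r q10 q20 -surjective_pairing.
have [b1 [b2 [v1 v2]]] := l2_ray_components _ (boundary_ray _ _ xir).
have /asymptotic_l2[as1 as2] := boundary_rays_asymptotic _ _ _ xir xis.
rewrite -(asymptotic_speed _ _ _ _ v1 (constant_speed_scale _ _ c0 r1) as1).
by rewrite -(asymptotic_speed _ _ _ _ v2 (constant_speed_scale _ _ s0 r2) as2).
Qed.

Lemma nbhs_cone_nbhd (Y : metricType R) (x : Y) (xi : boundary Y) (rho e : R) :
  0 < rho -> 0 < e ->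
  nbhs (inr xi : bordification Y) (cone_nbhd x xi rho e).
Proof.
move=> rho0 e0; apply: open_nbhs_nbhs; split; last by rewrite /cone_nbhd /= mdistxx.
exists [set cone_nbhd x xi rho e]; last by rewrite bigcup_set1.
move=> _ ->; apply: (@finI_from1 _ _ (@cone_subbase R Y) id).
by right; exists x, xi, rho, e.
Qed.

(** At time [rho] the segment and the ray have moved in the factors by [rho] times the cosine and
    sine of their slopes. Being within 1 there, they have cosines and sines that differ by less than
    1 / rho. *)
Lemma cone_nbhd_slope o xi th (e : R) : hadamard X1 -> hadamard X2 ->
  boundary_slope th xi -> 0 < e ->
  exists2 rho0 : R, 0 < rho0 & forall rho g, rho0 <= rho ->
    cone_nbhd o xi rho 1 (inl (act g o)) ->
    rho < mdist o (act g o) /\ `|orbit_slope o g - th| < e.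
Proof.
move=> hX1 hX2 xith e0.
have [thI _] := xith; have [_ gX1 _] := hX1; have [_ gX2 _] := hX2.
have [_ r0 v1 v2] := ray_from_slope o _ _ hX1 hX2 xith.
have [eta eta0 heta] := angle_close _ e0.
exists eta^-1; first by rewrite invr_gt0.
move=> rho g rho1 [rhoL near_r]; split=> //.
have rho0 : 0 < rho by apply: lt_le_trans rho1; rewrite invr_gt0.
have L0 : 0 < mdist o (act g o) by exact: lt_trans rhoL.
have [tI tc ts] := orbit_slopeP _ _ L0.
set L := mdist o (act g o) in rhoL L0 tc ts.
have [s0 sL gs] := segmentP o (act g o) (l2_geodesic_space gX1 gX2).
have [_ _ e1 e2] := l2_geodesic_components _ L rho L gs rho0 (ltW rhoL) (lexx _).
rewrite -/L in sL; rewrite s0 sL /= -tc -ts in e1 e2.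
have Ln0 : L != 0 by rewrite gt_eqF.
have {}e1 : mdist o.1 (segment o (act g o) rho).1 = rho * cos (orbit_slope o g).
  by apply: (mulfI Ln0); rewrite -e1; ring.
have {}e2 : mdist o.2 (segment o (act g o) rho).2 = rho * sin (orbit_slope o g).
  by apply: (mulfI Ln0); rewrite -e2; ring.
have f1 : mdist o.1 (ray_from o xi rho).1 = rho * cos th.
  have := v1 0 rho (lexx _) (ltW rho0); rewrite r0 => ->.
  by rewrite sub0r normrN gtr0_norm// mulrC.
have f2 : mdist o.2 (ray_from o xi rho).2 = rho * sin th.
  have := v2 0 rho (lexx _) (ltW rho0); rewrite r0 => ->.
  by rewrite sub0r normrN gtr0_norm// mulrC.
have close (Y : metricType R) (p q r : Y) (a b : R) : mdist p q = rho * a ->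
    mdist p r = rho * b -> mdist q r < 1 -> `|a - b| < eta.
  move=> pq pr qr; rewrite -(ltr_pM2l rho0) -{1}(gtr0_norm rho0) -normrM mulrBr.
  rewrite -pq -pr; apply: (@lt_le_trans _ _ 1).
    have h1 := mdist_triangle_lower p q r.
    have h2 := mdist_triangle_lower p r q.
    by rewrite (metric_sym r) in h2; rewrite ltr_norml; lra.
  by rewrite mulrC -ler_pdivrMl// mulr1.
apply: heta => //.
  apply: close e1 f1 _; exact: le_lt_trans (l2_mdist1 _ _) near_r.
apply: close e2 f2 _; exact: le_lt_trans (l2_mdist2 _ _) near_r.
Qed.

End slope.

(** * Orbit growth and radial limit points *)

Section growth.
Context {R : realType} {X1 X2 : metricType R}.
Notation X := (l2prod X1 X2).
Notation maps := ((X1 -> X1) * (X2 -> X2))%type.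
Implicit Types (G : set maps) (o : X) (g : maps) (xi : boundary X).

Lemma nat_round_up (d : R) : 0 <= d -> exists n : nat, n%:R - 1 < d <= n%:R.
Proof.
move=> d0; have ex : exists n : nat, d <= n%:R.
  by exists (Num.bound d); exact/ltW/archi_boundP.
exists (ex_minn ex); case: ex_minnP => -[|m] dm min.
  by rewrite dm andbT; lra.
rewrite dm andbT -natr1 addrK ltNge; apply/negP => /min.
by rewrite ltnn.
Qed.

Lemma growth_exponent_ge0 G o th xi : hadamard X1 -> hadamard X2 ->
  limit_set G o xi -> boundary_slope th xi ->
  (0 <= growth_exponent G o th)%E.
Proof.
move=> hX1 hX2 limxi slxi.
rewrite /growth_exponent /limf_einf oppe_ge0.
apply: (@le_trans _ _ (ereal_sup ((fun eps : R => - limn_esup (fun n =>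
    (n%:R^-1)%:E * lne (orbit_count G o th eps n)))%E @` [set e : R | 0 < e]))).
  apply: ereal_inf_lbound; exists [set e : R | 0 < e] => //.
  exact: nbhs_right_gt.
apply: ge_ereal_sup => _ [e /= e0 <-]; rewrite oppe_le0.
apply: le_ereal_inf_tmp => _ [V [N _ NV] <-].
have [rho0 rho00 h] := cone_nbhd_slope o _ _ _ hX1 hX2 slxi e0.
(* The bound [N] pushes the orbit point to a level [n >= N], where a nonempty count has logarithm at
   least 0. *)
pose rho := Num.max rho0 N%:R.
have rho_gt0 : 0 < rho by rewrite lt_max rho00.
have [_ [[g Gg <-] gc]] := limxi _ (nbhs_cone_nbhd _ o xi rho 1 rho_gt0 ltr01).
have [|rL slope] := h rho g _ gc; first by rewrite le_max lexx.
have L0 : 0 <= mdist o (act g o) by exact: mdist_ge0.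
have [n nL] := nat_round_up _ L0.
have Nn : (N <= n)%N.
  rewrite -(ler_nat R); move: nL => /andP[_]; apply: le_trans; apply: ltW.
  by apply: le_lt_trans rL; rewrite le_max lexx orbT.
apply: (@le_trans _ _ ((n%:R^-1)%:E * lne (orbit_count G o th e n))%E); last first.
  by apply: ereal_sup_ubound; exists n => //; exact: NV.
rewrite mule_ge0 ?lee_fin ?invr_ge0 ?ler0n// lne_ge0 /orbit_count /counting.
case: ifPn => [/asboolP fin|_]; last by rewrite leey.
rewrite lee_fin ler1n cardfs_gt0; apply/fset0Pn; exists g.
by rewrite in_fset_set//; exact/mem_set.
Qed.

Lemma growth_exponent_lt G o th (s e : R) :
  (growth_exponent G o th < s%:E)%E -> 0 < e ->
  exists eps : R, 0 < eps < e /\ exists N : nat, forall n, (N <= n)%N ->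
  exists2 A : seq maps, (size A)%:R <= expR (s * n%:R) &
    forall g, G g -> n%:R - 1 < mdist o (act g o) <= n%:R ->
      `|orbit_slope o g - th| < eps -> g \in A.
Proof.
rewrite /growth_exponent /limf_einf lteNl => gs e0.
set f := (X in limf_esup X) in gs.
have : ((- s%:E) < ereal_sup (f @` [set x : R | (0 < x < e)%R]))%E.
  apply: lt_le_trans gs _; apply: ereal_inf_lbound; eexists; last by [].
  near=> x; apply/andP; split; near: x; first exact: nbhs_right_gt.
  exact: nbhs_right_lt.
move=> /ereal_sup_gt[_ [eps epsI <-]]; rewrite /f lteN2 => /ereal_inf_lt.
move=> [_ [V [N _ NV] <-] Vs].
(* [N.+1] keeps [n] positive, so that the factor 1 / n can be cleared. *)
exists eps; split => //; exists N.+1 => n Nn.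
have : ((n%:R^-1)%:E * lne (orbit_count G o th eps n) < s%:E)%E.
  apply: le_lt_trans Vs; apply: ereal_sup_ubound; exists n => //.
  by apply: NV; exact: ltnW.
have n0 : 0 < n%:R :> R by rewrite ltr0n (leq_ltn_trans _ Nn).
rewrite lte_pdivrMl// /orbit_count /counting.
case: ifPn => [/asboolP fin|_ //].
set A := fset_set _ => As; exists (enum_fset A).
  (* An empty list is set apart, its count having logarithm -oo. *)
  have [A0|A0] := leqP (size (enum_fset A)) 0.
    by rewrite (eqP (_ : size _ == 0%N)) ?expR_ge0// -leqn0.
  move: As; rewrite lne_EFin ?ltr0n// -EFinM lte_fin => As.
  rewrite -(@lnK _ (size _)%:R) ?posrE ?ltr0n// ler_expR mulrC; exact: ltW.
by move=> g Gg gn gth; rewrite in_fset_set//; exact/mem_set.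
Unshelve. all: by end_near. Qed.

End growth.

(** * Radial limit points and shadows of orbit points *)

Section radial.
Context {R : realType}.

Lemma stays_near_speed (Y : metricType R) (u : nat -> Y) (eta : boundary Y)
    (s f : R -> Y) (a b : R) : eta s -> constant_speed a f -> a != 0 ->
  0 <= b -> asymptotic f (fun t => s (t * b)) -> stays_near_class u eta ->
  exists M : R, forall n, exists2 t, 0 <= t & mdist (u n) (f t) <= M.
Proof.
move=> etas fa a0 b0 fs [c etac [M uc]].
have rs := boundary_ray _ _ etas.
have ab := asymptotic_speed _ _ _ _ fa
  (constant_speed_scale _ _ b0 (fun=> rs)) fs.
have [M2 cs] := boundary_rays_asymptotic _ _ _ etac etas.
have [M3 fsM] := fs.
exists (M + (M2 + M3)) => n; have [t t0 utM] := uc n.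
have tb : 0 <= t / b by rewrite divr_ge0.
exists (t / b) => //.
have := fsM (t / b) tb; rewrite divfK -?ab// => h3.
have := cs t t0 => h2.
have t1 := metric_triangle (u n) (c t) (f (t / b)).
have t2 := metric_triangle (c t) (s t) (f (t / b)).
by rewrite metric_sym ab in h3; rewrite ab; lra.
Qed.

(** Replaces the unknown time [t] by one determined by [y], hence common to all rays passing near
    [y]. By the triangle inequality the two points of [f] are at most [M] apart. *)
Lemma near_projection (Y : metricType R) (x y : Y) (f : R -> Y) (a M t : R) :
  constant_speed a f -> f 0 = x -> 0 < a -> 0 <= t -> mdist y (f t) <= M ->
  mdist y (f (mdist x y / a)) <= 2 * M.
Proof.
move=> fa f0 a0 t0 yt.
have d0 : 0 <= mdist x y / a by rewrite divr_ge0 ?mdist_ge0// ltW.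
have ft : mdist x (f t) = a * t.
  by rewrite -f0 fa// sub0r normrN ger0_norm.
have h1 := mdist_triangle_lower x y (f t).
have h2 := mdist_triangle_lower x (f t) y.
rewrite (metric_sym (f t) y) in h2.
have : mdist (f t) (f (mdist x y / a)) <= M.
  rewrite fa// -{1}(ger0_norm (ltW a0)) -normrM mulrBr mulrCA divff ?gt_eqF//.
  by rewrite mulr1 ler_norml -ft; lra.
by have := metric_triangle y (f t) (f (mdist x y / a)); lra.
Qed.

Context {X1 X2 : metricType R}.
Notation X := (l2prod X1 X2).
Notation maps := ((X1 -> X1) * (X2 -> X2))%type.
Implicit Types (G : set maps) (o : X) (g : maps) (xi : boundary X).

(* The ray towards a point of slope th has speeds cos th and sin th in the
   factors, so it passes at distance d_i(o_i, g_i o_i) from o_i at the two times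
   below; a factor of speed 0 imposes no condition. *)
Definition shadow o th (M : R) g : set (boundary X) :=
  [set xi |
    (cos th != 0 -> mdist (g.1 o.1)
       (ray_from o xi (mdist o.1 (g.1 o.1) / cos th)).1 <= M) /\
    (sin th != 0 -> mdist (g.2 o.2)
       (ray_from o xi (mdist o.2 (g.2 o.2) / sin th)).2 <= M)].

Lemma radial_shadow G o th xi (e : R) : hadamard X1 -> hadamard X2 ->
  boundary_slope th xi -> radial_limit_set G o xi -> 0 < e ->
  exists M : R, forall L : R, exists g,
    [/\ G g, L < mdist o (act g o), `|orbit_slope o g - th| < e &
        shadow o th M g xi].
Proof.
move=> hX1 hX2 slxi [g [Gg gxi cases]] e0; have [thI _] := slxi.
have c0 := cos_quadrant_ge0 _ thI; have s0 := sin_quadrant_ge0 _ thI.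
have [xir r0 v1 v2] := ray_from_slope o _ _ hX1 hX2 slxi.
set r := ray_from o xi in xir r0 v1 v2.
have [M1 near1] : exists M : R, cos th != 0 -> forall n,
    exists2 t, 0 <= t & mdist ((g n).1 o.1) (r t).1 <= M.
  have [cth0|cth0] := eqVneq (cos th) 0; first by exists 0.
  (* Each case of the radial condition carries a slope of its own; comparing speeds identifies it
     with [th] or refutes the case. *)
  case: cases => [[eta1 [eta2 [th' [[th'I [s1 [s2 [es1 es2 xis]]]] st1 st2]]]]|
      [eta [s [x2 [es xis]]] st]|[eta [s [x1 [es xis]]] st]];
    have /asymptotic_l2[as1 as2] := boundary_rays_asymptotic _ _ _ xir xis.
  - have th'I' : 0 <= th' <= pi / 2 by move: th'I => /andP[? ?]; rewrite !ltW.
    have [M hM] := stays_near_speed _ _ _ _ _ _ _ es1 v1 cth0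
      (cos_quadrant_ge0 _ th'I') as1 st1.
    by exists M.
  - have as1' : asymptotic (fun t => (r t).1) (fun t => s (t * 1)).
      by have [M hM] := as1; exists M => t; rewrite mulr1; exact: hM.
    have [M hM] := stays_near_speed _ _ _ _ _ _ _ es v1 cth0 ler01 as1' st.
    by exists M.
  - have v0 : constant_speed 0 (fun _ : R => x1).
      by move=> *; rewrite mdistxx mul0r.
    by move: cth0; rewrite (asymptotic_speed _ _ _ _ v1 v0 as1) eqxx.
have [M2 near2] : exists M : R, sin th != 0 -> forall n,
    exists2 t, 0 <= t & mdist ((g n).2 o.2) (r t).2 <= M.
  have [sth0|sth0] := eqVneq (sin th) 0; first by exists 0.
  case: cases => [[eta1 [eta2 [th' [[th'I [s1 [s2 [es1 es2 xis]]]] st1 st2]]]]|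
      [eta [s [x2 [es xis]]] st]|[eta [s [x1 [es xis]]] st]];
    have /asymptotic_l2[as1 as2] := boundary_rays_asymptotic _ _ _ xir xis.
  - have th'I' : 0 <= th' <= pi / 2 by move: th'I => /andP[? ?]; rewrite !ltW.
    have [M hM] := stays_near_speed _ _ _ _ _ _ _ es2 v2 sth0
      (sin_quadrant_ge0 _ th'I') as2 st2.
    by exists M.
  - have v0 : constant_speed 0 (fun _ : R => x2).
      by move=> *; rewrite mdistxx mul0r.
    by move: sth0; rewrite (asymptotic_speed _ _ _ _ v2 v0 as2) eqxx.
  - have as2' : asymptotic (fun t => (r t).2) (fun t => s (t * 1)).
      by have [M hM] := as2; exists M => t; rewrite mulr1; exact: hM.
    have [M hM] := stays_near_speed _ _ _ _ _ _ _ es v2 sth0 ler01 as2' st.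
    by exists M.
exists (Num.max (2 * M1) (2 * M2)) => L.
have [rho0 rho00 h] := cone_nbhd_slope o _ _ _ hX1 hX2 slxi e0.
pose rho := Num.max rho0 L.
have rho_gt0 : 0 < rho by rewrite lt_max rho00.
have [N _ /(_ N (leqnn _)) /= gN] := gxi _ (nbhs_cone_nbhd _ o xi rho 1 rho_gt0 ltr01).
have [|rL slope] := h rho (g N) _ gN; first by rewrite le_max lexx.
exists (g N); split => //; first by apply: le_lt_trans rL; rewrite le_max lexx orbT.
split=> th0; rewrite le_max; apply/orP; [left|right].
  have [t t0 tM] := near1 th0 N.
  apply: near_projection v1 _ _ t0 tM; first by rewrite r0.
  by rewrite lt_neqAle eq_sym th0.
have [t t0 tM] := near2 th0 N.
apply: near_projection v2 _ _ t0 tM; first by rewrite r0.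
by rewrite lt_neqAle eq_sym th0.
Qed.

End radial.

(** * Covers by Knieper balls *)

Section hausdorff.
Context {R : realType} {Y : metricType R}.
Implicit Types (o : Y) (E : set (boundary Y)) (a c eps B : R).

Lemma esum_initial_const (L : nat) (x : R) : 0 <= x ->
  (\esum_(k in `I_L) x%:E = (L%:R * x)%:E)%E.
Proof.
move=> x0; rewrite esum_fset//.
rewrite -(fsbig_ord _ _ (fun=> x%:E)) sumEFin sumr_const card_ord.
by rewrite mulr_natl.
Qed.

Lemma esum_nat_le (b : nat -> R) B : (forall n, 0 <= b n) ->
  (forall n, \sum_(0 <= i < n) b i <= B) ->
  (\esum_(n in [set: nat]) (b n)%:E <= B%:E)%E.
Proof.
move=> b0 bB.
have -> : [set: nat] = [set n | xpredT n] by apply/seteqP.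
have <- := @nneseries_esum R (fun n => (b n)%:E) xpredT
  (fun n _ => (b0 n : (0 <= (b n)%:E)%E)).
apply: lime_le; first by apply: is_cvg_nneseries => n _ _; exact: (b0 n).
by apply: nearW => n; rewrite sumEFin; exact: bB.
Qed.

(** Level [n] contributes [L n] balls of common radius [r n]. The pairs (n, k) are pickled because
    covers are indexed by sets of natural numbers. *)
Lemma Hd_pre_le_sum o c a eps B E (L : nat -> nat)
    (xi : nat -> nat -> boundary Y) (r : nat -> R) :
  (forall n, (0 < L n)%N -> 0 < r n < expR (- c) /\ r n < eps) ->
  (forall zeta, E zeta -> exists n k, (k < L n)%N /\
     cball o c (xi n k) (r n) zeta) ->
  (forall n, \sum_(0 <= i < n) (L i)%:R * r i `^ a <= B) ->
  (Hd_pre o c a eps E <= B%:E)%E.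
Proof.
move=> hr hE hB.
pose D (n : nat) : set nat := `I_(L n).
pose dec (j : nat) : nat * nat := odflt (0%N, 0%N) (unpickle j).
have pickleK' p : dec (pickle p) = p by rewrite /dec pickleK.
apply: (@le_trans _ _ (\esum_(p in [set: nat] `*`` D) ((r p.1) `^ a)%:E)%E).
  apply: ereal_inf_lbound.
  exists (pickle @` ([set: nat] `*`` D)), (fun j => xi (dec j).1 (dec j).2),
    (fun j => r (dec j).1); split.
  - by move=> _ [p [_ Dp] <-]; rewrite pickleK'; apply: hr; exact: leq_ltn_trans Dp.
  - move=> zeta /hE[n [k [kL zc]]]; exists (pickle (n, k)).
      by exists (n, k).
    by rewrite pickleK'.
  - rewrite esum_image; first by apply: eq_esum => p _; rewrite pickleK'.
    by move=> p q _ _ /(congr1 dec); rewrite !pickleK'.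
rewrite -(@esum_esum R nat nat [set: nat] D (fun n _ => (r n `^ a)%:E)); last first.
  by move=> *; rewrite lee_fin powR_ge0.
rewrite (eq_esum (b := fun n => ((L n)%:R * r n `^ a)%:E)); last first.
  by move=> n _; rewrite esum_initial_const// powR_ge0.
by apply: esum_nat_le => // n; rewrite mulr_ge0 ?powR_ge0.
Qed.

Lemma Hd_pre_decreasing o c a E (e1 e2 : R) : e1 <= e2 ->
  (Hd_pre o c a e2 E <= Hd_pre o c a e1 E)%E.
Proof.
move=> e12; apply: le_ereal_inf_tmp => s [J [xi [r [hr cov ->]]]].
apply: ereal_inf_lbound; exists J, xi, r; split => // j /hr[h1 h2].
by split => //; exact: lt_le_trans e12.
Qed.

(** By monotonicity the limit exists and is a supremum over the scales. *)
Lemma Hd_le o c a B E : (forall e : R, 0 < e -> (Hd_pre o c a e E <= B%:E)%E) ->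
  (Hd o c a E <= B%:E)%E.
Proof.
move=> hB; rewrite /Hd.
have cv := @nonincreasing_at_right_cvge R (fun e => Hd_pre o c a e E) 0
  (BInfty R false) erefl.
rewrite (cvg_lim _ (cv _))//; last by move=> e1 e2 _ _; exact: Hd_pre_decreasing.
by apply: ge_ereal_sup => _ [e /= e0 <-]; apply: hB; move: e0; rewrite in_itv/= andbT.
Qed.

End hausdorff.

(** * Covering shadows by balls *)

Section covering.
Context {R : realType}.

(** At unit speed the two curves are segments of equal length from one point, and convexity applies
    at the fraction [u / T]. *)
Lemma constant_speed_contract (Y : metricType R) (f f' : R -> Y) (a u T : R) :
  CAT0 Y -> constant_speed a f -> constant_speed a f' -> f 0 = f' 0 ->
  0 < a -> 0 <= u <= T -> mdist (f u) (f' u) <= mdist (f T) (f' T).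
Proof.
move=> cat hf hf' ff' a0 /andP[u0 uT].
have [T0|Tn0] := eqVneq T 0.
  by have -> : u = 0 by [lra]; rewrite T0.
have T0 : 0 < T by rewrite lt_neqAle eq_sym Tn0 (le_trans u0).
have dT (h : R -> Y) : constant_speed a h -> mdist (h 0) (h T) = a * T.
  by move=> hh; rewrite hh ?(ltW T0)// sub0r normrN gtr0_norm.
have seg (h : R -> Y) : constant_speed a h ->
    is_segment (h 0) (h T) (fun t => h (t / a)).
  move=> hh; split; first by rewrite mul0r.
    by rewrite (dT _ hh) mulrAC divff ?gt_eqF// mul1r.
  move=> s t /=; rewrite !in_itv/= => /andP[s0 _] /andP[t0 _].
  rewrite hh ?divr_ge0 ?(ltW a0)// -mulrBl normrM normfV (gtr0_norm a0).
  by rewrite mulrCA divff ?gt_eqF// mulr1.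
have sg' := seg _ hf'; rewrite -ff' in sg'.
have l01 : 0 <= u / T <= 1.
  by rewrite divr_ge0 ?(ltW T0)//= ler_pdivrMr// mul1r.
have := cat0_convex _ _ _ _ _ _ cat (seg _ hf) sg' l01.
have d' := dT _ hf'; rewrite -ff' in d'.
rewrite (dT _ hf) d'.
have -> : u / T * (a * T) / a = u.
  by field; rewrite Tn0 gt_eqF.
move/le_trans; apply; rewrite ler_piMl ?mdist_ge0//.
by case/andP: l01.
Qed.

Context {X1 X2 : metricType R}.
Notation X := (l2prod X1 X2).
Notation maps := ((X1 -> X1) * (X2 -> X2))%type.
Implicit Types (G : set maps) (o : X) (g : maps) (xi : boundary X).

Lemma isom_net (Y : metricType R) (h : Y -> Y) (x y : Y) (M e : R) (Z : seq Y) :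
  isom h -> (forall z, mdist x z <= M -> exists2 w, w \in Z & mdist w z < e) ->
  mdist (h x) y <= M -> exists2 w, w \in Z & mdist (h w) y < e.
Proof.
move=> [hd hs] hZ; have [z <-] := hs y; rewrite hd => /hZ[w wZ wz].
by exists w; rewrite ?hd.
Qed.

Lemma component_close (Y : metricType R) (f f' : R -> Y) (p : Y) (a d u e : R) :
  CAT0 Y -> constant_speed a f -> constant_speed a f' -> f 0 = f' 0 ->
  0 <= a -> 0 <= u -> a * u <= d -> 0 < e ->
  (a != 0 -> mdist p (f (d / a)) < e / 2) ->
  (a != 0 -> mdist p (f' (d / a)) < e / 2) -> mdist (f u) (f' u) < e.
Proof.
move=> cat hf hf' ff' a0 u0 aud e0 h1 h2.
have [a_eq0|an0] := eqVneq a 0.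
  have fc (h : R -> Y) : constant_speed a h -> h u = h 0.
    by move=> hh; apply: mdist_positivity; rewrite hh// a_eq0 mul0r.
  by rewrite (fc _ hf) (fc _ hf') ff' mdistxx.
have a_gt0 : 0 < a by rewrite lt_neqAle eq_sym an0.
have uT : 0 <= u <= d / a by rewrite u0 ler_pdivlMr// mulrC.
apply: le_lt_trans (constant_speed_contract _ _ _ _ _ _ cat hf hf' ff' a_gt0 uT) _.
have := h1 an0; have := h2 an0.
have := metric_triangle (f (d / a)) p (f' (d / a)).
by rewrite (metric_sym _ p); lra.
Qed.

(* Pulled back by g_i^-1, the points at which the rays of a shadow leave the
   distance d_i(o_i, g_i o_i) all lie in one ball around o_i, so that a finite
   net of that ball serves every g; in a CAT(0) space rays from o_i which are
   close at that distance are close before it. *)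
Lemma shadows_cover o (xi0 : boundary X) th (M c : R) :
  hadamard X1 -> hadamard X2 ->
  locally_compact [set: X1] -> locally_compact [set: X2] ->
  0 <= th <= pi / 2 -> 0 < c ->
  exists K : nat, forall (u : R) (A : seq maps), 0 <= u ->
    (forall g, g \in A -> isom g.1 /\ isom g.2) ->
  exists xi : nat -> boundary X, forall zeta g, boundary_slope th zeta ->
    g \in A -> cos th * u <= mdist o.1 (g.1 o.1) ->
    sin th * u <= mdist o.2 (g.2 o.2) -> shadow o th M g zeta ->
    exists k, (k < K * size A)%N /\
      mdist (ray_from o zeta u) (ray_from o (xi k) u) < c.
Proof.
move=> hX1 hX2 lc1 lc2 thI c0; have [cX1 gX1 cat1] := hX1.
have [cX2 gX2 cat2] := hX2.
(* Two rays within [c / 4] of the same translated net point are within [c / 2] of each other in that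
   factor, and the two factors add up to [c]. *)
have c8 : 0 < c / 4 by rewrite divr_gt0.
have c4 : 0 < c / 2 by rewrite divr_gt0.
have [Z1 hZ1] := hopf_rinow o.1 (Num.max M 0) cX1 gX1 lc1 _ c8.
have [Z2 hZ2] := hopf_rinow o.2 (Num.max M 0) cX2 gX2 lc2 _ c8.
pose Z := [seq (z1, z2) | z1 <- Z1, z2 <- Z2].
exists (size Z) => u A u0 isoA.
pose T := [seq (z, g) | z <- Z, g <- A].
pose piece (p : (X1 * X2) * maps) : set (boundary X) := [set zeta |
  [/\ boundary_slope th zeta,
      cos th * u <= mdist o.1 (p.2.1 o.1),
      sin th * u <= mdist o.2 (p.2.2 o.2),
      cos th != 0 -> mdist (p.2.1 p.1.1)
        (ray_from o zeta (mdist o.1 (p.2.1 o.1) / cos th)).1 < c / 4 &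
      sin th != 0 -> mdist (p.2.2 p.1.2)
        (ray_from o zeta (mdist o.2 (p.2.2 o.2) / sin th)).2 < c / 4]].
(* Each nonempty piece supplies a centre of slope [th]; [xi0] only fills the indices of empty
   pieces. *)
have /choice[xi hxi] : forall k : nat, exists xi : boundary X,
   piece (nth (o, (id, id)) T k) !=set0 -> piece (nth (o, (id, id)) T k) xi.
  move=> k; have [[xi hxi]|nxi] := pselect (piece (nth (o, (id, id)) T k) !=set0).
    by exists xi.
  by exists xi0 => /nxi.
exists xi => zeta g slz gA ug1 ug2 [sh1 sh2].
have [i1 i2] := isoA g gA.
have [z1 z1Z hz1] : exists2 z, z \in Z1 & cos th != 0 -> mdist (g.1 z)
      (ray_from o zeta (mdist o.1 (g.1 o.1) / cos th)).1 < c / 4.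
  (* At speed 0 any net point will do; the maximum with 0 in the radius keeps [o.1] in the ball and
     so ensures that there is one. *)
  have [ct|ct] := eqVneq (cos th) 0.
    have [|z zZ _] := hZ1 o.1; last by exists z.
    by rewrite /= mdistxx le_max lexx orbT.
  have [|z zZ zr] := isom_net _ _ _ _ _ _ _ i1 hZ1 (_ : mdist (g.1 o.1)
      (ray_from o zeta (mdist o.1 (g.1 o.1) / cos th)).1 <= _).
    by rewrite le_max sh1.
  by exists z.
have [z2 z2Z hz2] : exists2 z, z \in Z2 & sin th != 0 -> mdist (g.2 z)
      (ray_from o zeta (mdist o.2 (g.2 o.2) / sin th)).2 < c / 4.
  have [ct|ct] := eqVneq (sin th) 0.
    have [|z zZ _] := hZ2 o.2; last by exists z.
    by rewrite /= mdistxx le_max lexx orbT.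
  have [|z zZ zr] := isom_net _ _ _ _ _ _ _ i2 hZ2 (_ : mdist (g.2 o.2)
      (ray_from o zeta (mdist o.2 (g.2 o.2) / sin th)).2 <= _).
    by rewrite le_max sh2.
  by exists z.
have pT : ((z1, z2), g) \in T.
  by apply: allpairs_f => //; apply: allpairs_f.
exists (index ((z1, z2), g) T); split.
  by rewrite -(size_allpairs pair) index_mem.
have := hxi (index ((z1, z2), g) T); rewrite nth_index//.
case; first by exists zeta.
set xik := xi _ => slx _ _ /= h1 h2.
have [_ r0 v1 v2] := ray_from_slope o _ _ hX1 hX2 slz.
have [_ r0' v1' v2'] := ray_from_slope o _ _ hX1 hX2 slx.
apply: le_lt_trans (l2_mdist_le _ _) _.
have -> : c = c / 2 + c / 2 by lra.
have c48 : c / 2 / 2 = c / 4 by lra.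
apply: ltrD.
  apply: (component_close _ _ _ (g.1 z1) _ _ _ _ cat1 v1 v1' _ _ u0 ug1 c4);
    rewrite ?c48 ?r0 ?r0'//; exact: cos_quadrant_ge0.
apply: (component_close _ _ _ (g.2 z2) _ _ _ _ cat2 v2 v2' _ _ u0 ug2 c4);
  rewrite ?c48 ?r0 ?r0'//; exact: sin_quadrant_ge0.
Qed.

End covering.

(* The widths of the shadows used at level n may tend to infinity with n while the
   numbers K of balls they cost stay at most n: one cover then deals with all
   radial points at once, and the polynomial factor is harmless. *)
Lemma slow_choice (K : nat -> nat) : exists m : nat -> nat,
  [/\ forall n, (K 0 <= n)%N -> (K (m n) <= n)%N &
      forall j, exists N, forall n, (N <= n)%N -> (j <= m n)%N].
Proof.
(* An empty maximum is 0, hence the condition [K 0 <= n]. *)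
exists (fun n => \max_(i < n | (K i <= n)%N) i)%N; split.
  move=> n K0; elim/big_ind : _ => //.
  by move=> x y hx hy; rewrite maxnE; case: (leqP x y) => [/subnKC ->|/ltnW/eqP ->];
    rewrite ?addn0.
move=> j; exists (maxn j.+1 (K j)) => n; rewrite geq_max => /andP[jn Kj].
exact: (@leq_bigmax_cond _ (fun i : 'I_n => (K i <= n)%N) (fun i => i)
  (Ordinal jn) Kj).
Qed.

(** Half of the decay [2 * e] absorbs the factor [i], as [i%:R <= expR (e * i%:R) / e]; the other
    half leaves a geometric series. *)
Lemma poly_exp_geometric_sum (R : realType) (a e : R) (n : nat) (b : nat -> R) :
  0 < e -> (forall i, 0 <= b i <= i%:R * expR (a - 2 * e * i%:R)) ->
  \sum_(0 <= i < n) b i <= expR a / e / (1 - expR (- e)).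
Proof.
move=> e0 hb.
have q1 : expR (- e) < 1 by rewrite expR_lt1 oppr_lt0.
apply: (@le_trans _ _ (series (geometric (expR a / e) (expR (- e))) n)).
  apply: ler_sum => i _; have /andP[_ /le_trans] := hb i; apply.
  have ie : i%:R <= expR (e * i%:R) / e.
    by rewrite ler_pdivlMr// mulrC; have := expR_ge1Dx (e * i%:R); lra.
  apply: le_trans (ler_wpM2r (expR_ge0 _) ie) _.
  rewrite /geometric /= -expRM_natl mulrAC -expRD [leRHS]mulrAC -expRD.
  by rewrite le_eqVlt; apply/orP; left; apply/eqP; congr (expR _ / _); ring.
apply: geometric_le_lim; rewrite ?divr_ge0 ?expR_ge0 ?expR_gt0 ?(ltW e0)//.
by rewrite gtr0_norm ?expR_gt0.
Qed.

Lemma real_between (R : realType) (x : \bar R) (a : R) : (x < a%:E)%E ->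
  (0 <= x)%E -> exists s : R, 0 <= s < a /\ (x < s%:E)%E.
Proof.
case: x => [x| |] //; rewrite lte_fin lee_fin => xa x0.
by exists ((x + a) / 2); rewrite lte_fin; lra.
Qed.

Lemma lee_real_ub (R : realType) (x y : \bar R) : (0 <= y)%E ->
  (forall a : R, (y < a%:E)%E -> (x <= a%:E)%E) -> (x <= y)%E.
Proof.
case: y => [y| |] // y0 h; last by rewrite leey.
by apply/lee_addgt0Pr => e e0; apply: h; rewrite lte_fin ltrDl.
Qed.

(** * Finiteness of the measure above the exponent of growth *)

Section dimension.
Context {R : realType} {X1 X2 : metricType R}.
Notation X := (l2prod X1 X2).
Notation maps := ((X1 -> X1) * (X2 -> X2))%type.
Implicit Types (G : set maps) (o : X) (g : maps) (xi : boundary X).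

Lemma shadow_le o th (M M' : R) g : M <= M' ->
  shadow o th M g `<=` shadow o th M' g.
Proof.
by move=> MM' xi [h1 h2]; split=> th0; apply: le_trans MM'; [exact: h1|exact: h2].
Qed.

Lemma Hd_radial_lt_pinfty G o th (c a : R) (xi0 : boundary X) :
  hadamard X1 -> hadamard X2 ->
  locally_compact [set: X1] -> locally_compact [set: X2] ->
  (forall g, G g -> isom g.1 /\ isom g.2) ->
  0 < c -> 0 <= th <= pi / 2 ->
  (0 <= growth_exponent G o th)%E -> (growth_exponent G o th < a%:E)%E ->
  (Hd o c a (radial_limit_set G o `&` boundary_slope th) < +oo)%E.
Proof.
move=> hX1 hX2 lc1 lc2 isoG c0 thI d0 da.
have [s [/andP[s0 sa] ds]] := real_between _ _ _ da d0.
have a0 : 0 < a by exact: le_lt_trans sa.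
(* Shadows at level n are covered by balls of radius expR (- l * (n - 1)). The
   factor l < 1 makes up for the deviation of the slopes from th; any l with
   s < l * a will do. *)
pose l := (s + a) / (2 * a).
have la : l * a = (s + a) / 2 by rewrite /l; field; rewrite gt_eqF.
have l0 : 0 < l by rewrite /l divr_gt0 ?mulr_gt0//; lra.
have l1 : l < 1 by rewrite /l ltr_pdivrMr ?mulr_gt0//; lra.
(* The net decay rate per level is [l * a - s = 2 * e]. *)
pose e := (a - s) / 4.
have e0 : 0 < e by rewrite /e; lra.
have [eps1 eps10 ratio] := quadrant_ratio _ _ thI l1.
have [eps [/andP[eps0 eps_lt] [N countN]]] := growth_exponent_lt _ _ _ _ _ ds eps10.
have /choice[K hK] := fun m : nat =>
  shadows_cover o xi0 th m%:R c hX1 hX2 lc1 lc2 thI c0.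
have [m [Km minf]] := slow_choice K.
(* The bound does not involve the scale [del], which only decides from which level on balls are
   used. *)
apply: (@le_lt_trans _ _ (expR (l * a) / e / (1 - expR (- e)))%:E); last exact: ltry.
apply: Hd_le => del del0.
(* The lists are cut down to [G] because nets are transported by isometries. *)
have /choice[A hA] : forall n, exists A : seq maps, (forall g, g \in A -> G g) /\
    ((N <= n)%N -> (size A)%:R <= expR (s * n%:R) /\
     forall g, G g -> n%:R - 1 < mdist o (act g o) <= n%:R ->
      `|orbit_slope o g - th| < eps -> g \in A).
  move=> n; have [Nn|nN] := leqP N n; last by exists [::].
  have [A sA hA] := countN n Nn; exists [seq g <- A | `[<G g>]]; split.
    by move=> g; rewrite mem_filter => /andP[/asboolP].
  move=> _; split.
    by apply: le_trans sA; rewrite ler_nat size_filter count_size.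
  move=> g Gg gn gs; rewrite mem_filter hA// andbT; exact/asboolP.
pose u (n : nat) := l * (n%:R - 1).
have [n0 n0P] : exists n0 : nat, forall n, (n0 <= n)%N ->
    [/\ (N <= n)%N, (K 0 <= n)%N, 0 <= u n, c < u n & - ln del < u n].
  pose B := (c + `|ln del|) / l + 1.
  exists (maxn N (maxn (K 0%N) (Num.bound B))) => n.
  rewrite !geq_max => /and3P[Nn Kn Bn].
  have B0 : 0 <= B by rewrite addr_ge0// divr_ge0 ?addr_ge0// ltW.
  have Bn' : B < n%:R.
    by apply: lt_le_trans (archi_boundP B0) _; rewrite ler_nat.
  have un : c + `|ln del| < u n.
    by rewrite /u mulrC -ltr_pdivrMr//; rewrite /B in Bn'; lra.
  have := ler_norm (- ln del); rewrite normrN => h.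
  have := normr_ge0 (ln del) => h'.
  by split => //; lra.
have isoA n g : g \in A n -> isom g.1 /\ isom g.2.
  by move=> /(hA n).1; exact: isoG.
have /choice[xi xiP] : forall n, exists xi : nat -> boundary X, (n0 <= n)%N ->
    forall zeta g, boundary_slope th zeta ->
    g \in A n -> cos th * u n <= mdist o.1 (g.1 o.1) ->
    sin th * u n <= mdist o.2 (g.2 o.2) -> shadow o th (m n)%:R g zeta ->
    exists k, (k < K (m n) * size (A n))%N /\
      mdist (ray_from o zeta (u n)) (ray_from o (xi k) (u n)) < c.
  move=> n; have [nn|nn] := leqP n0 n; last by exists (fun=> xi0).
  have [_ _ u0 _ _] := n0P n nn.
  by have [xi xiP] := hK (m n) (u n) (A n) u0 (isoA n); exists xi.
pose L n := (if (n0 <= n)%N then K (m n) * size (A n) else 0)%N.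
apply: (@Hd_pre_le_sum _ _ _ _ _ _ _ _ L xi (fun n => expR (- u n))).
- move=> n; rewrite /L; case: ifPn => // /n0P[_ _ _ cu delu] _.
  rewrite expR_gt0 ltr_expR ltrN2 cu; split => //.
  by rewrite -(@lnK _ del) ?posrE// ltr_expR ltrNl.
- move=> zeta [zrad zsl].
  have [M hM] := radial_shadow _ _ _ _ _ hX1 hX2 zsl zrad eps0.
  have [j Mj] : exists j : nat, M <= j%:R.
    by exists (Num.bound `|M|); apply: le_trans (ler_norm _) _;
      exact/ltW/archi_boundP.
  have [N' mN'] := minf j.
  (* Beyond [n0] the level is in use, and beyond [N'] its shadows are at least as wide as the
     constant [M] of this point. *)
  have [g [Gg gL gsl gsh]] := hM (maxn n0 N')%:R.
  have d_ge0 : 0 <= mdist o (act g o) by exact: mdist_ge0.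
  have [n gn] := nat_round_up _ d_ge0.
  have : (maxn n0 N' <= n)%N.
    by rewrite -(ler_nat R); move: gn => /andP[_]; apply: le_trans; exact: ltW.
  rewrite geq_max => /andP[nn0 nN'].
  have [Nn _ un0 _ _] := n0P n nn0.
  have gA : g \in A n by apply: ((hA n).2 Nn).2.
  have gpos : 0 < mdist o (act g o) by apply: le_lt_trans gL; exact: ler0n.
  have [gI gc gs] := orbit_slopeP _ _ gpos.
  have [r1 r2] := ratio _ gI (lt_trans gsl eps_lt).
  have und : u n <= l * mdist o (act g o).
    by rewrite /u ler_pM2l//; move: gn => /andP[/ltW].
  have c_ge0 := cos_quadrant_ge0 _ thI; have s_ge0 := sin_quadrant_ge0 _ thI.
  have b1 : cos th * u n <= mdist o.1 (g.1 o.1).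
    rewrite -gc; apply: le_trans (ler_wpM2l c_ge0 und) _.
    by rewrite mulrA (mulrC _ l) [leLHS]mulrC ler_pM2l.
  have b2 : sin th * u n <= mdist o.2 (g.2 o.2).
    rewrite -gs; apply: le_trans (ler_wpM2l s_ge0 und) _.
    by rewrite mulrA (mulrC _ l) [leLHS]mulrC ler_pM2l.
  have mM : M <= (m n)%:R by apply: le_trans Mj _; rewrite ler_nat mN'.
  have [k [kL close]] := xiP n nn0 zeta g zsl gA b1 b2 (shadow_le _ _ _ _ _ mM _ gsh).
  exists n, k; split; first by rewrite /L nn0.
  by rewrite /cball /= expRK opprK.
- move=> n; apply: poly_exp_geometric_sum => // i.
  rewrite mulr_ge0 ?powR_ge0//= /L; case: ifPn => [/n0P[Ni Ki _ _ _]|_]; last first.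
    by rewrite mul0r mulr_ge0 ?expR_ge0.
  have [sz _] := (hA i).2 Ni.
  (* Growth of the count plus decay of the radii; the shift by 1 in [u] produces the constant
     [l * a]. *)
  have -> : l * a - 2 * e * i%:R = s * i%:R + - u i * a.
    rewrite /u.
    have -> : s * i%:R + - (l * (i%:R - 1)) * a = s * i%:R - l * a * i%:R + l * a.
      by ring.
    by rewrite la /e; field.
  rewrite expRD natrM -mulrA ler_pM ?mulr_ge0 ?powR_ge0 ?ler0n ?ler_nat ?Km//.
  rewrite -expRM ler_pM2r ?expR_gt0//.
Qed.

End dimension.

Theorem theoremF (R : realType) (X1 X2 : metricType R)
  (hX1 : hadamard X1) (hX2 : hadamard X2)
  (lcX1 : locally_compact [set: X1]) (lcX2 : locally_compact [set: X2])
  (G : set ((X1 -> X1) * (X2 -> X2)))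
  (groupG : isom_group G) (discreteG : discrete_in_isom G)
  (g h : (X1 -> X1) * (X2 -> X2)) (Gg : G g) (Gh : G h)
  (indep1 : independent_rank_one g.1 h.1)
  (indep2 : independent_rank_one g.2 h.2)
  (o : l2prod X1 X2) (c : R) (c_gt0 : 0 < c)
  (theta : R) (theta_itv : 0 <= theta <= pi / 2)
  (limit_theta : (limit_set G o `&` boundary_slope theta) !=set0) :
  (dim_Hd o c (radial_limit_set G o `&` boundary_slope theta)
     <= growth_exponent G o theta)%E.
Proof.
have [xi0 [lim0 sl0]] := limit_theta.
have [isoG _ _ _] := groupG.
have d0 := growth_exponent_ge0 _ _ _ _ hX1 hX2 lim0 sl0.
apply: (lee_real_ub _ _ _ d0) => a da; apply: ereal_inf_lbound; exists a => //; split.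
  by rewrite -lee_fin; apply: le_trans d0 _; exact: ltW.
exact: (Hd_radial_lt_pinfty _ _ _ _ _ xi0).
Qed.
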